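(* Let $T$ be an infinite, locally finite tree and let $M$ be a positive integer. If $T$ is transient, then integer-valued $M$-Lipschitz functions on $T$ are localized; if $T$ is not transient (i.e. $T$ is recurrent), then integer-valued $M$-Lipschitz functions on $T$ are delocalized.
   Context: Trees are connected. A tree is transient (recurrent) if the simple random walk on it is transient (recurrent). An integer-valued $M$-Lipschitz function on a graph $G$ is a function $\phi:V(G)\to\mathbb{Z}$ with $|\phi(u)-\phi(v)|\le M$ for every edge $(u,v)$ of $G$. Zero boundary conditions: fix a vertex $v^*\in V(T)$. For a finite connected set $\Lambda\subset V(T)$ containing $v^*$, let $\partial\Lambda$ be the set of vertices outside $\Lambda$ adjacent to a vertex of $\Lambda$, and let $\phi_\Lambda$ be uniformly chosen among the (finitely many) integer-valued $M$-Lipschitz functions on the subtree induced on $\Lambda\cup\partial\Lambda$ that equal $0$ on $\partial\Lambda$. Integer-valued $M$-Lipschitz functions on $T$ are localized if for every $v^*\in V(T)$ the family of laws of $\phi_\Lambda(v^* )$, over all finite connected $\Lambda\ni v^*$, is tight. They are delocalized if for every $v^*\in V(T)$ and every $A>0$, $\mathbb{P}(|\phi_\Lambda(v^* )|\le A)\to 0$ as the distance from $v^*$ to $\partial\Lambda$ tends to infinity (that is, for every $\varepsilon>0$ there is $n$ such that this probability is less than $\varepsilon$ for every finite connected $\Lambda\ni v^*$ with $\mathrm{dist}(v^*,\partial\Lambda)\ge n$). *)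

(* Defs.v *)
From HB Require Import structures.
From mathcomp Require Import all_boot all_order all_algebra finmap.
From mathcomp Require Import all_classical all_reals all_analysis.

Set Implicit Arguments.
Unset Strict Implicit.
Unset Printing Implicit Defensive.

Import Order.TTheory GRing.Theory Num.Theory.
Local Open Scope fset_scope.
Local Open Scope classical_set_scope.
Local Open Scope ring_scope.

Section Graph.
Context (V : choiceType) (e : rel V).

Definition connected_graph : Prop :=
  forall x y : V, exists2 p : seq V, path e x p & last x p = y.

(* Cycles have at least three vertices: a pair of adjacent vertices is a
   ucycle of size two. *)
Definition acyclic : Prop :=
  forall c : seq V, (2 < size c)%N -> ~ ucycle e c.

Record is_tree : Prop := IsTree {
  tree_sym : symmetric e;
  tree_irr : irreflexive e;
  tree_connected : connected_graph;
  tree_acyclic : acyclic }.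

Definition locally_finite : Prop := forall x : V, finite_set [set y | e x y].

Definition deg (x : V) : nat := #|` fset_set [set y | e x y] |.

Definition dist_ge (x y : V) (n : nat) : Prop :=
  forall p : seq V, path e x p -> last x p = y -> (n <= size p)%N.

Definition connected_in (L : {fset V}) : Prop :=
  forall x y : V, x \in L -> y \in L ->
    exists p : seq V, [/\ path e x p, last x p = y & {subset p <= L}].

(* fset_set is meaningful here because boundaries of finite sets are finite
   in a locally finite graph. *)
Definition bdry (L : {fset V}) : {fset V} :=
  fset_set [set u | u \notin L /\ exists2 w, w \in L & e w u].

End Graph.

Section RandomWalk.
Context (R : realType) (V : choiceType) (e : rel V).

(* Probability that the simple random walk started at x makes
   its first (size s) steps along s. *)
Fixpoint walk_prob (x : V) (s : seq V) : R :=
  if s is y :: s' then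
    (if e x y then (deg e x)%:R^-1 else 0) * walk_prob y s'
  else 1.

(* P_v(X_n = v for some n >= 1): the event is the disjoint union, over the
   finite sequences t avoiding v, of the events that the walk follows t and
   then steps to v. *)
Definition return_prob (v : V) : \bar R :=
  \esum_(t in [set t : seq V | v \notin t]) (walk_prob v (rcons t v))%:E.

Definition transient : Prop := forall v : V, (return_prob v < 1)%E.

End RandomWalk.

Section Lipschitz.
Context (R : realType) (V : choiceType) (e : rel V) (M : nat).

Definition height_fun (L : {fset V}) := {ffun (L `|` bdry e L)%fset -> int}.

Definition lipschitz0 (L : {fset V}) : set (height_fun L) :=
  [set phi : height_fun L |
     (forall x y : (L `|` bdry e L)%fset,
        e (val x) (val y) -> `|phi x - phi y| <= M%:Z) /\
     (forall x : (L `|` bdry e L)%fset, val x \in bdry e L -> phi x = 0)].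

(* phi v, with the value 0 off the domain of phi. *)
Definition height (L : {fset V}) (phi : height_fun L) (v : V) : int :=
  oapp phi 0 (insub v).

(* The law of phi_L(v) for phi_L uniform in lipschitz0 L. This set is finite
   (and contains 0) when e is an infinite, locally finite, connected graph. *)
Definition height_law (L : {fset V}) (v : V) (B : set int) : R :=
  #|` fset_set (lipschitz0 (L := L) `&` [set phi : height_fun L | B (height phi v)]) |%:R /
  #|` fset_set (lipschitz0 (L := L)) |%:R.

(* The compact subsets of the discrete space int are the finite ones. *)
Definition tight (F : set (set int -> R)) : Prop :=
  forall eps : R, 0 < eps ->
    exists2 K : set int, finite_set K & forall mu, F mu -> mu (~` K) < eps.

Definition localized : Prop :=
  forall v : V,
    tight [set height_law L v | L in [set L | connected_in e L /\ v \in L]].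

Definition delocalized : Prop :=
  forall (v : V) (A : R), 0 < A ->
  forall eps : R, 0 < eps ->
  exists n : nat, forall L : {fset V},
    connected_in e L -> v \in L ->
    (forall u : V, u \in bdry e L -> dist_ge e v u n) ->
    height_law L v [set k : int | `|k%:~R : R| <= A] < eps.

End Lipschitz.

(* Main.v *)
(* Rooting the tree at v, the number f_x(k) of admissible functions on the
   subtree of x taking the value k at x satisfies
     f_x = \prod_(c child of x) (f_c convolved with 1_[-M, M]),
   with f_x = 1_{0} on the boundary, and P(phi(v) = k) is proportional to f_v(k).
   Each f_x is even, so it is described by its ratios r(k) = f(k+1) / f(k), k >= 0.
   Two one-parameter classes of functions behave like electrical conductances:
   - steep a:  1 / r(k) >= 1 + a (k + 1 - M)^+ for all k;
   - gentle b: r is nonincreasing with steps at most b, starting from r(0) >= 1 - b/2.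
   In both classes the parameter adds up under products (parallel law), while the
   convolution maps a to a / (1 + C a), respectively b to b - c b^2 <= b / (1 + c b)
   (series law). The first flat M values are exempted in "steep" because the
   convolution of a concentrated function is nearly constant on [0, M].
   If the walk is transient, the probability H(x) of hitting v gives the numbers
   1 - H(c) / H(parent of c), which satisfy the recursion of unit conductances and
   bound the steepness at v from below, uniformly in the domain. Conversely the
   gentleness parameters b_x of a domain define a positive superharmonic function
   h with h(c) = h(parent of c) / (1 + c b_c), which bounds the probability of
   returning to v before reaching the boundary by 1 - c b_v / deg v; if v is
   recurrent, b_v must be small once the boundary is far. Delocalization at one
   vertex gives it at all vertices by the Lipschitz property. *)

Require Import Defs.
From mathcomp Require Import all_boot all_order all_algebra finmap.
From mathcomp Require Import all_classical all_reals all_analysis.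
From mathcomp Require Import zify ring lra.

Set Implicit Arguments.
Unset Strict Implicit.
Unset Printing Implicit Defensive.

Import Order.TTheory GRing.Theory Num.Theory numFieldNormedType.Exports.
Local Open Scope ring_scope.

(** * Convolution of even functions with an interval *)

Section Convolution.
Context (R : realFieldType) (M : nat).
Implicit Types (f g : nat -> R) (k : nat).

(* Even functions on the integers are encoded by their restriction to nat;
   conv f is the convolution of f with the indicator of [-M, M]. *)
Definition conv f k : R :=
  \sum_(j < M.*2.+1) f `|(k%:Z + j%:Z - M%:Z)%R|%N.

Lemma conv_high f k : (M <= k)%N ->
  conv f k = \sum_(j < M.*2.+1) f (k - M + j)%N.
Proof. by move=> Mk; apply: eq_bigr => j _; congr f; lia. Qed.

(** The window [[k - M, k + M]] contains the origin here, and its negative part folds onto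
    [[1, M - k]] by evenness. *)
Lemma conv_low f k : (k <= M)%N ->
  conv f k = \sum_(i < (k + M).+1) f i + \sum_(i < M - k) f i.+1.
Proof.
move=> kM; rewrite /conv.
rewrite -(big_mkord xpredT (fun j => f `|(k%:Z + j%:Z - M%:Z)%R|%N)).
rewrite (@big_cat_nat _ _ _ (M - k)) /=; [|lia|lia].
rewrite addrC; congr (_ + _).
  rewrite -{1}[(M - k)%N]add0n big_addn.
  rewrite (_ : (M.*2.+1 - (M - k) = (k + M).+1)%N); last lia.
  by rewrite big_mkord; apply: eq_bigr => i _; congr f; lia.
rewrite big_mkord (reindex_inj rev_ord_inj) /=.
by apply: eq_bigr => i _; congr f; have := ltn_ord i; lia.
Qed.

Lemma convS f k :
  conv f k.+1 = conv f k + f (k + M).+1 - f `|(k%:Z - M%:Z)%R|%N.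
Proof.
rewrite /conv [in LHS]big_ord_recr [in RHS]big_ord_recl /=.
have -> : `|(k%:Z + 0%:Z - M%:Z)%R|%N = `|(k%:Z - M%:Z)%R|%N by rewrite addr0.
have -> : `|(k.+1%:Z + M.*2%:Z - M%:Z)%R|%N = (k + M).+1 by lia.
rewrite [RHS]addrAC [X in X - _]addrC addrK; congr (_ + _).
by apply: eq_bigr => j _; congr f; rewrite /bump /=; lia.
Qed.

Lemma conv_norm f (z : int) :
  \sum_(j < M.*2.+1) f `|(z + j%:Z - M%:Z)%R|%N = conv f `|(z)%R|%N.
Proof.
case: z => k //; rewrite /conv (reindex_inj rev_ord_inj) /=.
by apply: eq_bigr => j _; congr f; have := ltn_ord j; lia.
Qed.

Lemma conv_ge0 f k : (forall i, 0 <= f i) -> 0 <= conv f k.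
Proof. by move=> f0; apply: sumr_ge0 => i _. Qed.

Lemma conv_gt0 f : (forall i, 0 <= f i) -> 0 < f 0%N -> 0 < conv f 0.
Proof.
move=> f0 f00; rewrite conv_low // big_ord_recl /=.
rewrite -addrA ltr_wpDr ?addr_ge0 ?sumr_ge0 //.
Qed.

Lemma decr_le f : (forall i, f i.+1 <= f i) ->
  forall i j, (i <= j)%N -> f j <= f i.
Proof.
move=> df i j /subnK <-; elim: (j - i)%N => [|n IH]; first by rewrite add0n.
by rewrite addSn (le_trans (df _)).
Qed.

Lemma conv_decr f : (forall i, f i.+1 <= f i) -> forall k, conv f k.+1 <= conv f k.
Proof.
move=> df k; rewrite convS -addrA gerDl subr_le0; apply: decr_le => //; lia.
Qed.

Lemma conv_le f k : (forall i, f i.+1 <= f i) -> conv f k <= M.*2.+1%:R * f 0%N.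
Proof.
move=> df; rewrite mulr_natl -[X in _ *+ X]card_ord -sumr_const.
by apply: ler_sum => i _; apply: decr_le.
Qed.

End Convolution.

(** * Steep functions: parallel and series laws *)

Section Steep.
Context (R : realFieldType) (M : nat).
Implicit Types (f g : nat -> R) (a b : R).

(** Stated without division because [f] may vanish, as the boundary delta does; the truncated
    subtraction is the positive part of [k + 1 - M]. *)
Definition steep a f : Prop :=
  [/\ 0 < f 0%N, forall k, 0 <= f k &
      forall k, f k.+1 * (1 + a * (k.+1 - M)%:R) <= f k].

Lemma steep_weaken a b f : b <= a -> steep a f -> steep b f.
Proof.
move=> ba [f0 fp fs]; split => // k; apply: le_trans (fs k).
by rewrite ler_wpM2l // lerD2l ler_wpM2r.
Qed.

Lemma steep_decr a f : 0 <= a -> steep a f -> forall k, f k.+1 <= f k.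
Proof.
move=> a0 [f0 fp fs] k; apply: le_trans (fs k).
by rewrite ler_peMr // lerDl mulr_ge0.
Qed.

Lemma steep_delta a : steep a (fun k => (k == 0)%:R).
Proof. by split => // k; rewrite /= ?ler0n // mul0r. Qed.

Lemma steep_mul a b f g : 0 <= a -> 0 <= b -> steep a f -> steep b g ->
  steep (a + b) (fun k => f k * g k).
Proof.
move=> a0 b0 [f0 fp fs] [g0 gp gs]; split => [|k|k]; rewrite ?mulr_gt0 ?mulr_ge0 //.
apply: (le_trans _ (ler_pM _ _ (fs k) (gs k))); rewrite ?mulr_ge0 ?addr_ge0 ?mulr_ge0 //.
rewrite mulrACA ler_wpM2l ?mulr_ge0 //; set l := _%:R.
have l0 : 0 <= l by rewrite ler0n.
have : 0 <= a * l * (b * l) by rewrite !mulr_ge0.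
lra.
Qed.

Lemma steep_prod (I : finType) (P : pred I) (a : I -> R) (f : I -> nat -> R) :
  (forall i, P i -> 0 <= a i) -> (forall i, P i -> steep (a i) (f i)) ->
  steep (\sum_(i | P i) a i) (fun k => \prod_(i | P i) f i k).
Proof.
move=> a0 fa; elim: (index_enum I) => [|i s IH].
  by rewrite big_nil; split => [|k|k]; rewrite !big_nil ?mul0r ?addr0 ?mulr1.
suff : steep (\sum_(j <- i :: s | P j) a j)
    (fun k => if P i then f i k * \prod_(j <- s | P j) f j k
              else \prod_(j <- s | P j) f j k).
  case=> h1 h2 h3; split => [|k|k]; rewrite !big_cons.
  - exact: h1.
  - exact: h2.
  - by rewrite -(big_cons _ _ _ _ P a); exact: h3.
rewrite big_cons; case: ifP => Pi //.
by apply: steep_mul => //; [exact: a0|exact: sumr_ge0|exact: fa].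
Qed.

(** Constant of the second-order error in [extremal_mean]: the window has [2M + 1] points, their
    offsets from the centre are at most [M], and [extremal] falls across it by a relative amount of
    at most [2M (M + 1)] times [a (q + 1)]. *)
Definition spread : R := M.*2.+1%:R * M%:R * (M.*2 * M.+1)%:R.

Lemma spread_ge0 : 0 <= spread. Proof. by rewrite !mulr_ge0. Qed.

Lemma centered_sum : \sum_(i < M.*2.+1) (i%:R - M%:R) = 0 :> R.
Proof.
suff : \sum_(i < M.*2.+1) (i%:R - M%:R) = - \sum_(i < M.*2.+1) (i%:R - M%:R) :> R.
  by move=> h; lra.
rewrite [LHS](reindex_inj rev_ord_inj) /= -sumrN; apply: eq_bigr => i _.
rewrite subSS natrB; last by rewrite -ltnS ltn_ord.
have -> : M.*2%:R = M%:R + M%:R :> R by rewrite -addnn natrD.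
lra.
Qed.

Section Window.
Context (q : nat) (a : R).
Hypothesis a0 : 0 <= a.

Let l i : nat := ((q + i).+1 - M)%N.

(* The slowest decay allowed by steep a on the window starting at q; by
   cross_sums it is the worst case for the decay of the convolution at q + M. *)
Definition extremal i : R := \prod_(j < i) (1 + a * (l j)%:R)^-1.

Lemma extremal_gt0 i : 0 < extremal i.
Proof.
by apply: prodr_gt0 => j _; rewrite invr_gt0 ltr_wpDr ?mulr_ge0.
Qed.

Lemma extremalS i : extremal i = (1 + a * (l i)%:R) * extremal i.+1.
Proof.
rewrite /extremal big_ord_recr /= mulrC mulfVK // gt_eqF //.
by rewrite ltr_wpDr ?mulr_ge0.
Qed.

Lemma extremal_lower i : (i <= M.*2)%N ->
  extremal 1 * (1 - a * (i * (M.+1 * q.+1))%:R) <= extremal i.+1 <= extremal 1.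
Proof.
elim: i => [|i IH] iM; first by rewrite mul0n mulr0 subr0 mulr1 lexx.
have /andP[lo hi] := IH (ltnW iM).
have s1 := extremal_gt0 1; have s2 := extremal_gt0 i.+2.
have E := extremalS i.+1; have l0 : 0 <= a * (l i.+1)%:R by rewrite mulr_ge0.
have ll : a * (l i.+1)%:R <= a * (M.+1 * q.+1)%:R.
  by rewrite ler_wpM2l // ler_nat /l; nia.
have le12 : extremal i.+2 <= extremal i.+1.
  by rewrite [leRHS]E ler_peMl ?lerDl // ltW.
rewrite (le_trans le12 hi) andbT mulSn natrD.
have : a * (l i.+1)%:R * extremal i.+2 <= a * (M.+1 * q.+1)%:R * extremal 1.
  apply: ler_pM => //; first exact: ltW.
  exact: le_trans le12 hi.
move: lo; rewrite E; lra.
Qed.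

(** By [extremalS] the two plain sums differ by [a] times the sum of [l i] weighted by
    [extremal i.+1]. The unweighted mean of [l] is at least [q + 1] by [centered_sum], and replacing
    the weights by the constant [extremal 1] costs a relative error of at most [spread * a]. *)
Lemma extremal_mean :
  \sum_(i < M.*2.+1) extremal i.+1 * (1 + a * (1 - spread * a) * q.+1%:R)
    <= \sum_(i < M.*2.+1) extremal i.
Proof.
set t : R := q.+1%:R.
rewrite -subr_ge0 -sumrB.
have -> : \sum_(i < M.*2.+1) (extremal i -
    extremal i.+1 * (1 + a * (1 - spread * a) * t)) =
  a * \sum_(i < M.*2.+1) extremal i.+1 * ((l i)%:R - t + spread * a * t).
  by rewrite mulr_sumr; apply: eq_bigr => i _; rewrite extremalS; ring.
apply: mulr_ge0 => //.
pose c : R := a * (M.*2 * (M.+1 * q.+1))%:R.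
have c0 : 0 <= c by rewrite mulr_ge0.
have s1 := extremal_gt0 1.
have lower (i : 'I_M.*2.+1) : extremal 1 * (i%:R - M%:R) - extremal 1 * c * M%:R
    + extremal i.+1 * (spread * a * t)
    <= extremal i.+1 * ((l i)%:R - t + spread * a * t).
  rewrite [leRHS]mulrDr lerD2r.
  have iM : (i <= M.*2)%N by rewrite -ltnS ltn_ord.
  have /andP[lo hi] := extremal_lower iM.
  have li : i%:R - M%:R <= (l i)%:R - t.
    have : i%:R + t <= (l i)%:R + M%:R by rewrite /t -!natrD ler_nat /l; lia.
    lra.
  apply: (@le_trans _ _ (extremal i.+1 * (i%:R - M%:R))); last first.
    by rewrite ler_wpM2l // ltW // extremal_gt0.
  have d0 : 0 <= extremal 1 - extremal i.+1 by rewrite subr_ge0.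
  have dc : extremal 1 - extremal i.+1 <= extremal 1 * c.
    move: lo; rewrite mulrBr mulr1 lerBlDr -lerBlDl => /le_trans -> //.
    by rewrite ler_pM2l // /c ler_wpM2l // ler_nat leq_mul2r iM orbT.
  have iM' : i%:R - M%:R <= M%:R :> R.
    by rewrite lerBlDr -natrD ler_nat addnn.
  have : (extremal 1 - extremal i.+1) * (i%:R - M%:R) <= extremal 1 * c * M%:R.
    apply: (@le_trans _ _ ((extremal 1 - extremal i.+1) * M%:R)).
      exact: ler_wpM2l.
    exact: ler_wpM2r.
  lra.
apply: (@le_trans _ _ (\sum_(i < M.*2.+1) (extremal 1 * (i%:R - M%:R) -
    extremal 1 * c * M%:R + extremal i.+1 * (spread * a * t)))); last first.
  by apply: ler_sum => i _; apply: lower.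
rewrite big_split sumrB /= -mulr_sumr centered_sum mulr0 sub0r.
rewrite sumr_const card_ord -mulr_suml addrC subr_ge0.
apply: (@le_trans _ _ (extremal 1 * (spread * a * t))).
  rewrite /spread /c /t -mulr_natr !natrM le_eqVlt; apply/orP; left.
  by apply/eqP; ring.
apply: ler_wpM2r; first by rewrite !mulr_ge0 ?spread_ge0.
by rewrite big_ord_recl /= lerDl sumr_ge0 // => i _; rewrite ltW // extremal_gt0.
Qed.

End Window.

(** The inner terms shared by the shifted sums contribute the same product to both sides; the three
    products left over are each ordered by the hypothesis that [f / g] is nonincreasing. *)
Lemma cross_sums n (f g : nat -> R) : (forall i, 0 <= f i) -> (forall i, 0 <= g i) ->
  (forall i j, (i <= j)%N -> f j * g i <= f i * g j) ->
  (\sum_(i < n) f i.+1) * (\sum_(i < n) g i) <=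
  (\sum_(i < n) f i) * (\sum_(i < n) g i.+1).
Proof.
move=> f0 g0 fg; case: n => [|n]; first by rewrite !big_ord0 mul0r.
rewrite !(big_ord_recl n (fun i => f (nat_of_ord i)))
        !(big_ord_recl n (fun i => g (nat_of_ord i))) /=.
rewrite !(big_ord_recr n) /=.
pose X := \sum_(i < n) f i.+1; pose Y := \sum_(i < n) g i.+1.
rewrite -[\sum_(i < n) f (bump 0 i)]/X -[\sum_(i < n) g (bump 0 i)]/Y.
rewrite -/X -/Y.
have h1 : X * g 0%N <= f 0%N * Y.
  by rewrite mulr_suml mulr_sumr ler_sum // => i _; apply: fg.
have h2 : f n.+1 * Y <= X * g n.+1.
  by rewrite mulr_suml mulr_sumr ler_sum // => i _; apply: fg; exact: (leqW (ltn_ord i)).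
have h3 := fg 0%N n.+1 (leq0n _).
lra.
Qed.

Lemma steep_conv_small a f : 0 <= a -> steep a f ->
  steep (a * (1 - spread * a)) (conv M f).
Proof.
move=> a0 sf; have df := steep_decr a0 sf; case: sf => f0 fp fs.
split => [|k|k]; [exact: conv_gt0|exact: conv_ge0|].
have [kM|] := leqP k.+1 M.
  move: (kM); rewrite -subn_eq0 => /eqP ->; rewrite mulr0 addr0 mulr1.
  exact: conv_decr.
rewrite ltnS => Mk; pose q := (k - M)%N.
have -> : (k.+1 - M)%N = q.+1 by rewrite /q; lia.
rewrite !conv_high //; last exact: leqW.
have cross := @cross_sums M.*2.+1 (fun i => f (q + i)%N) (extremal q a).
have sp := extremal_gt0 q a0; have sm := extremal_mean q a0.
have S0 : 0 < \sum_(i < M.*2.+1) extremal q a i.+1.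
  by rewrite big_ord_recl ltr_pwDl // sumr_ge0 // => i _; apply: ltW.
rewrite -(ler_pM2r S0).
have {}cross := cross (fun i => fp _) (fun i => ltW (sp i)).
have Sk : \sum_(j < M.*2.+1) f (k.+1 - M + j)%N = \sum_(j < M.*2.+1) f (q + j.+1)%N.
  by apply: eq_bigr => j _; congr f; rewrite /q; lia.
apply: le_trans (cross _).
  rewrite Sk -[leLHS]mulrA ler_wpM2l ?sumr_ge0 //.
  by rewrite mulrC mulr_suml.
(* [f / extremal] is nonincreasing: each step of [f] decays at least by the factor that defines
   [extremal]. *)
move=> i j /subnK <-; elim: (j - i)%N => [|d IH] //; rewrite addSn.
rewrite (extremalS q a0 (d + i)) in IH.
have c0 : 0 < 1 + a * ((q + (d + i)).+1 - M)%:R by rewrite ltr_wpDr ?mulr_ge0.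
rewrite -(ler_pM2r c0).
have := fs (q + (d + i))%N; rewrite -addnS => fs1.
have := ler_wpM2r (ltW (sp i)) fs1; rewrite addnS in fs1 *; lra.
Qed.

(** The 4 makes [(1 - s) (1 + 4 s) >= 1] for [s = spread * a <= 1/2]; the 1 keeps the constant
    positive when [M = 0]. *)
Definition loss : R := 4 * spread + 1.

Lemma loss_gt0 : 0 < loss. Proof. by have := spread_ge0; rewrite /loss; lra. Qed.

Lemma steep_conv a f : 0 <= a -> steep a f -> steep (a / (1 + loss * a)) (conv M f).
Proof.
move=> a0 sf; have s0 := spread_ge0.
have l0 : 0 < 1 + loss * a by rewrite ltr_wpDr ?mulr_ge0 // ltW ?loss_gt0.
have sa := mulr_ge0 s0 a0.
have [small|big] := lerP (2 * spread * a) 1.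
  apply: steep_weaken (steep_conv_small a0 sf).
  rewrite ler_pdivrMr // -mulrA ler_peMr // /loss.
  have : 0 <= a * (1 - 2 * spread * a) by rewrite mulr_ge0 ?subr_ge0.
  have : 0 <= spread * a * (1 - 2 * spread * a) by rewrite mulr_ge0 ?subr_ge0.
  lra.
have sp : 0 < spread by rewrite lt_neqAle s0 andbT; apply/eqP => z; move: big; rewrite -z; lra.
(* For large [a], weaken to the maximiser of [a * (1 - spread * a)]; the maximum [1 / (4 * spread)]
   exceeds [a / (1 + loss * a)]. *)
pose a' := (2 * spread)^-1.
have a'E : a' * spread = 2^-1 by rewrite /a'; field; lra.
have a'0 : 0 <= a' by rewrite invr_ge0; lra.
have a'a : a' <= a.
  by rewrite -(ler_pM2r sp) a'E; lra.
apply: steep_weaken (steep_conv_small a'0 (steep_weaken a'a sf)).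
rewrite ler_pdivrMr // [spread * a']mulrC a'E /loss.
have -> : a' * (1 - 2^-1) * (1 + (4 * spread + 1) * a) =
  2^-1 * (a' + a' * a + 4 * (a' * spread) * a) by field.
by rewrite a'E; have := mulr_ge0 a'0 a0; lra.
Qed.

End Steep.

(** * Gentle functions: parallel law, and convolution away from the origin *)

Section Gentle.
Context (R : realFieldType).
Implicit Types (f g r : nat -> R) (b : R).

(** The ratio is a separate sequence because [f] may vanish. The bound at 0 is half a step because
    the slope of an even function changes sign at the origin. *)
Definition gentle_ratio b f r : Prop :=
  [/\ forall k, f k.+1 = r k * f k, forall k, 0 <= r k,
      forall k, r k.+1 <= r k <= r k.+1 + b & 1 - b / 2 <= r 0%N <= 1].

Definition gentle b f : Prop := 0 < f 0%N /\ exists r, gentle_ratio b f r.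

Section Ratio.
Context (b : R) (f r : nat -> R).
Hypotheses (f00 : 0 < f 0%N) (fr : gentle_ratio b f r).

Lemma ratio_decr i j : (i <= j)%N -> r j <= r i.
Proof. by apply: decr_le => k; case: fr => _ _ /(_ k)/andP[]. Qed.

Lemma ratio_le1 k : r k <= 1.
Proof. by apply: le_trans (ratio_decr (leq0n k)) _; case: fr => _ _ _ /andP[]. Qed.

Lemma gentle_ge0 k : 0 <= f k.
Proof.
case: fr => fE r0 _ _; elim: k => [|k IH]; first exact: ltW.
by rewrite fE mulr_ge0.
Qed.

Lemma gentle_decr k : f k.+1 <= f k.
Proof. by case: fr => fE _ _ _; rewrite fE ler_piMl ?gentle_ge0 ?ratio_le1. Qed.

(** The slope [1 - r j] is at most [b (j + 1)], so [f] falls at most quadratically and stays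
    comparable to [f 0] up to distances of order [b^(-1/2)]. *)
Lemma gentle_lower k : 0 <= b -> f 0%N * (1 - b * (k ^ 2)%:R) <= f k.
Proof.
case: fr => fE r0 rb /andP[rb0 r01] b0.
have step j : 1 - r j <= b * j.+1%:R.
  elim: j => [|j IH]; first by move: rb0; rewrite mulr1; lra.
  by have /andP[_] := rb j; rewrite -natr1 mulrDr mulr1; lra.
elim: k => [|k IH]; first by rewrite exp0n // mulr0 subr0 mulr1.
have fk := decr_le gentle_decr (leq0n k).
have : f k * (1 - r k) <= f 0%N * (b * k.+1%:R).
  by apply: ler_pM => //; [exact: gentle_ge0|rewrite subr_ge0 ratio_le1].
have -> : (k.+1 ^ 2)%:R = (k ^ 2)%:R + k%:R + k.+1%:R :> R.
  by rewrite -!natrD; congr _%:R; lia.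
have : 0 <= f 0%N * (b * k%:R) by rewrite !mulr_ge0 // ltW.
move: IH; rewrite fE; lra.
Qed.

End Ratio.

Lemma gentle_weaken b c f : b <= c -> gentle b f -> gentle c f.
Proof.
move=> bc [f0 [r [fE r0 rb rb0]]]; split => //; exists r; split => //.
  by move=> k; have := rb k; lra.
by move: rb0; lra.
Qed.

(** Ratios in [[0, 1]] have steps at most 1 and [r 0 >= 0], so the parameter 2 always suffices; the
    cap brings [b] into the range of [gentle_conv]. *)
Lemma gentle_cap b f : gentle b f -> gentle (Num.min b 2) f.
Proof.
move=> gf; have [//|_] := leP b 2; case: gf => f0 [r fr]; split => //.
exists r; have r1 := ratio_le1 fr; case: fr => fE r0 rb rb0; split => //.
  move=> k; have /andP[-> _] := rb k; have := r1 k; have := r0 k.+1; lra.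
by move: rb0 (r0 0%N); lra.
Qed.

Lemma gentle_delta : gentle 2 (fun k => (k == 0)%:R).
Proof.
split; first exact: ltr01.
by exists (fun=> 0); split => [k|k|k|]; rewrite ?mul0r //; lra.
Qed.

Lemma gentle_mul b c f g : gentle b f -> gentle c g ->
  gentle (b + c) (fun k => f k * g k).
Proof.
move=> [f0 [r fr]] [g0 [s gs]]; split; first exact: mulr_gt0.
have r1 := ratio_le1 fr; have s1 := ratio_le1 gs.
case: fr => fE r0 rb rb0; case: gs => gE s0 sb sb0.
exists (fun k => r k * s k); split => [k|k|k|].
- by rewrite fE gE mulrACA.
- exact: mulr_ge0.
- have /andP[rk rk'] := rb k; have /andP[sk sk'] := sb k; rewrite ler_pM //=.
  have : r k * (s k - s k.+1) <= s k - s k.+1 by rewrite ler_piMl // subr_ge0.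
  have : (r k - r k.+1) * s k.+1 <= r k - r k.+1 by rewrite ler_piMr // subr_ge0.
  lra.
- move: rb0 sb0 => /andP[rk rk'] /andP[sk sk']; rewrite mulr_ile1 // andbT.
  have : 0 <= (1 - r 0%N) * (1 - s 0%N) by rewrite mulr_ge0 ?subr_ge0.
  lra.
Qed.

Lemma gentle_prod (I : finType) (P : pred I) (b : I -> R) (f : I -> nat -> R) :
  (forall i, P i -> gentle (b i) (f i)) ->
  gentle (\sum_(i | P i) b i) (fun k => \prod_(i | P i) f i k).
Proof.
move=> fb; elim: (index_enum I) => [|i s IH].
  rewrite big_nil; split => [|]; rewrite ?big_nil //; exists (fun=> 1).
  by split => [k|k|k|]; rewrite ?big_nil ?mul1r ?mul0r ?addr0 ?subr0 ?lexx.
suff : gentle (\sum_(j <- i :: s | P j) b j)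
    (fun k => if P i then f i k * \prod_(j <- s | P j) f j k
              else \prod_(j <- s | P j) f j k).
  case=> h1 [r [h2 h3 h4 h5]]; split; first by rewrite big_cons; exact: h1.
  by exists r; split => // k; rewrite !big_cons; exact: h2.
by rewrite big_cons; case: ifP => Pi //; apply: gentle_mul => //; apply: fb.
Qed.

(* Chebyshev's sum inequality, keeping one pair of terms. *)
Lemma chebyshev_pair n (w x y : nat -> R) :
  (forall i, 0 <= w i) -> (forall i j, (i <= j)%N -> x j <= x i) ->
  (forall i j, (i <= j)%N -> y j <= y i) ->
  w 0%N * w 1%N * (x 0%N - x 1%N) * (y 0%N - y 1%N) <=
  (\sum_(i < n.+2) w i) * (\sum_(i < n.+2) w i * (x i * y i)) -
  (\sum_(i < n.+2) w i * x i) * (\sum_(i < n.+2) w i * y i).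
Proof.
move=> w0 xd yd.
pose G i j := w i * w j * (x i - x j) * (y i - y j).
have G0 i j : 0 <= G i j.
  rewrite /G -mulrA; apply: mulr_ge0; first exact: mulr_ge0.
  have [ij|/ltnW ij] := leqP i j.
    by rewrite mulr_ge0 // subr_ge0 ?xd ?yd.
  by rewrite mulr_le0 // subr_le0 ?xd ?yd.
have E : \sum_(i < n.+2) \sum_(j < n.+2) G i j = 2 *
  ((\sum_(i < n.+2) w i) * (\sum_(i < n.+2) w i * (x i * y i)) -
  (\sum_(i < n.+2) w i * x i) * (\sum_(i < n.+2) w i * y i)).
  rewrite mulr2n mulrDl mul1r {1}[in X in _ = X + _]mulrC
    {1}[in X in _ = X + _](mulrC (\sum_(i < n.+2) w i * x i)) !mulr_suml -!sumrB -big_split.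
  apply: eq_bigr => i _; rewrite !mulr_sumr -!sumrB -big_split.
  by apply: eq_bigr => j _; rewrite /G /=; ring.
suff : 2 * G 0%N 1%N <= \sum_(i < n.+2) \sum_(j < n.+2) G i j.
  by rewrite E /G; lra.
have -> : 2 * G 0%N 1%N = G 0%N 1%N + G 1%N 0%N by rewrite /G; ring.
rewrite big_ord_recl big_ord_recl addrA ler_wpDr //.
  by apply: sumr_ge0 => i _; apply: sumr_ge0.
apply: lerD.
  by rewrite big_ord_recl big_ord_recl /= ler_wpDl // ler_wpDr // sumr_ge0.
by rewrite big_ord_recl ler_wpDr // sumr_ge0.
Qed.

(** With [A], [S], [T] three consecutive values of the convolution, [S / A - T / S] is the step of
    its ratio. It is nonnegative by [cross_sums], and the saving of order [b ^+ 2] comes from the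
    first two terms of the window. *)
Lemma high_gap n b f r : 0 <= b <= 2 -> (forall k, 0 <= f k) ->
  (forall k, f k.+1 = r k * f k) -> (forall k, 0 <= r k <= 1) ->
  (forall k, r k.+1 <= r k <= r k.+1 + b) ->
  0 <= (\sum_(i < n.+2) f i.+1) ^+ 2 -
         (\sum_(i < n.+2) f i) * (\sum_(i < n.+2) f i.+2)
    <= (b - b ^+ 2 / (16 * n.+2%:R ^+ 2)) *
         ((\sum_(i < n.+2) f i.+1) * (\sum_(i < n.+2) f i)).
Proof.
move=> /andP[b0 b2] fp fE r01 rb.
set A := \sum_(i < n.+2) f i; set S := \sum_(i < n.+2) f i.+1.
set T := \sum_(i < n.+2) f i.+2.
have r0 k : 0 <= r k by case/andP: (r01 k).
have rd : forall i j, (i <= j)%N -> r j <= r i.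
  by apply: decr_le => k; case/andP: (rb k).
have fd k : f k.+1 <= f k by rewrite fE ler_piMl //; case/andP: (r01 k).
apply/andP; split.
  rewrite subr_ge0 expr2 mulrC; apply: (@cross_sums _ n.+2 (fun i => f i.+1) f) => // i j ij.
  by rewrite [f j.+1]fE [f i.+1]fE mulrAC ler_wpM2r // ler_wpM2r // rd.
have A0 : 0 <= A by apply: sumr_ge0.
have S0 : 0 <= S by apply: sumr_ge0.
set N : R := n.+2%:R.
have N1 : 1 <= N by rewrite /N ler1n.
have AN : A <= N * f 0%N.
  rewrite mulr_natl -[X in _ *+ X]card_ord -sumr_const.
  by apply: ler_sum => i _; apply: decr_le.
have SA : S <= r 0%N * A.
  by rewrite mulr_sumr; apply: ler_sum => i _; rewrite fE ler_wpM2r // rd.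
pose d i := r i - r i.+1.
have db i : 0 <= d i <= b by have := rb i; rewrite /d; lra.
pose D := \sum_(i < n.+2) f i * d i.
(* Chebyshev for [r i] and [r i.+1] with weights [f] bounds [A * T] below by [S * (S - D)] plus the
   pair term. *)
have cheb := @chebyshev_pair n f r (fun i => r i.+1) fp rd (fun i j ij => rd i.+1 j.+1 ij).
have SE : \sum_(i < n.+2) f i * r i = S by apply: eq_bigr => i _; rewrite fE mulrC.
have TE : \sum_(i < n.+2) f i * (r i * r i.+1) = T.
  by apply: eq_bigr => i _; rewrite !fE; ring.
have DE : \sum_(i < n.+2) f i * r i.+1 = S - D.
  by rewrite -SE -sumrB; apply: eq_bigr => i _; rewrite /d; ring.
rewrite SE TE DE -/A [f 1%N]fE in cheb.
have {}cheb : f 0%N * (r 0%N * f 0%N) * d 0%N * d 1%N <= A * T - S * (S - D) := cheb.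
have main : S ^+ 2 - A * T <= S * D - f 0%N * (r 0%N * f 0%N) * d 0%N * d 1%N.
  by rewrite expr2; lra.
apply: le_trans main _.
have DA : D <= b * A - (b - d 0%N) * f 0%N - (b - d 1%N) * (r 0%N * f 0%N).
  rewrite /D /A !big_ord_recl /= -fE.
  have : \sum_(i < n) f (bump 0 (bump 0 i)) * d (bump 0 (bump 0 i)) <=
         b * \sum_(i < n) f (bump 0 (bump 0 i)).
    rewrite mulr_sumr; apply: ler_sum => i _; rewrite mulrC ler_wpM2r //.
    by case/andP: (db (bump 0 (bump 0 i))).
  rewrite -[bump 0 0]/1%N; lra.
have f0 := fp 0%N; have r00 := r0 0%N.
have /andP[d00 d0b] := db 0%N; have /andP[d10 d1b] := db 1%N.
have d0r : d 0%N <= r 0%N by rewrite /d gerBl.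
have P0 : 0 <= r 0%N * f 0%N by rewrite mulr_ge0.
have P1 : 0 <= S * f 0%N by rewrite mulr_ge0.
have P2 : 0 <= S * (r 0%N * f 0%N) by rewrite mulr_ge0.
have SD := ler_wpM2l S0 DA.
(* [G] is the saving over [b * (S * A)]. Either one of the first two steps is at most [b / 2], or
   both exceed it and the pair term is large. *)
pose G := S * ((b - d 0%N) * f 0%N + (b - d 1%N) * (r 0%N * f 0%N))
  + f 0%N * (r 0%N * f 0%N) * d 0%N * d 1%N.
suff : b ^+ 2 / (16 * N ^+ 2) * (S * A) <= G.
  by move: SD; rewrite /G; set q := b ^+ 2 / _; lra.
have N0 : 0 < 16 * N ^+ 2 by rewrite mulr_gt0 // exprn_gt0 // ltr0n.
rewrite mulrAC ler_pdivrMr //.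
have SA0 : 0 <= S * A by rewrite mulr_ge0.
have SAN : S * A <= S * f 0%N * N.
  by rewrite -mulrA (mulrC (f 0%N)) ler_wpM2l.
have dd : 0 <= d 0%N * d 1%N by rewrite mulr_ge0.
have G1 : 0 <= f 0%N * (r 0%N * f 0%N) * d 0%N * d 1%N by rewrite -mulrA !mulr_ge0.
have G2 : 0 <= S * ((b - d 1%N) * (r 0%N * f 0%N)) by rewrite !mulr_ge0 // subr_ge0.
have G3 : 0 <= S * ((b - d 0%N) * f 0%N) by rewrite !mulr_ge0 // subr_ge0.
have bb : b ^+ 2 <= 2 * b by rewrite expr2 ler_wpM2r.
have NN : N <= N ^+ 2 by rewrite expr2 ler_peMl // (le_trans ler01).
have hb : 0 <= b / 2 by rewrite divr_ge0.
have step1 : b ^+ 2 * (S * A) <= b ^+ 2 * (S * f 0%N * N).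
  by rewrite ler_wpM2l ?sqr_ge0.
have step2 : b ^+ 2 * (S * f 0%N * N) <= b ^+ 2 * (S * f 0%N) * N ^+ 2.
  by rewrite mulrA ler_wpM2l // mulr_ge0 ?sqr_ge0.
have [small0|big0] := lerP (d 0%N) (b / 2).
  apply: (le_trans step1); apply: (le_trans step2).
  rewrite [leRHS]mulrA ler_wpM2r ?sqr_ge0 //.
  have : (b / 2) * (S * f 0%N) <= (b - d 0%N) * (S * f 0%N) by rewrite ler_wpM2r //; lra.
  have : b ^+ 2 * (S * f 0%N) <= 2 * b * (S * f 0%N) by rewrite ler_wpM2r.
  have : 0 <= b * (S * f 0%N) by rewrite mulr_ge0.
  rewrite /G; lra.
(* Now [d 0 > b / 2] forces [r 0 >= b / 2], so the second point of the window carries at least that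
   share of [f 0]. *)
have [small1|big1] := lerP (d 1%N) (b / 2).
  apply: (le_trans step1); apply: (le_trans step2).
  rewrite [leRHS]mulrA ler_wpM2r ?sqr_ge0 //.
  have h1 : b / 2 <= b - d 1%N by clear - small1; lra.
  have h2 : b / 2 <= r 0%N by apply: le_trans d0r; exact: ltW.
  have := ler_pM hb hb h1 h2; move=> /(ler_wpM2r P1).
  have : 0 <= b ^+ 2 * (S * f 0%N) by rewrite mulr_ge0 ?sqr_ge0.
  rewrite /G expr2; lra.
have := ler_pM hb hb (ltW big0) (ltW big1).
move=> dd4.
have SAf : S * A <= r 0%N * (f 0%N * f 0%N) * N ^+ 2.
  apply: (@le_trans _ _ (r 0%N * A * A)); first by rewrite ler_wpM2r.
  rewrite -mulrA -[leRHS]mulrA ler_wpM2l //.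
  have -> : f 0%N * f 0%N * N ^+ 2 = (N * f 0%N) * (N * f 0%N) by ring.
  exact: ler_pM.
have rf0 : 0 <= r 0%N * (f 0%N * f 0%N) by rewrite !mulr_ge0.
have h1 := ler_wpM2r rf0 dd4.
have h2 : b ^+ 2 * (S * A) <= b ^+ 2 * (r 0%N * (f 0%N * f 0%N) * N ^+ 2).
  by rewrite ler_wpM2l ?sqr_ge0.
apply: (le_trans h2).
rewrite [leLHS]mulrA [leRHS]mulrA ler_wpM2r ?sqr_ge0 //.
have : 0 <= b ^+ 2 * (r 0%N * (f 0%N * f 0%N)) by rewrite mulr_ge0 ?sqr_ge0.
rewrite /G expr2; lra.
Qed.

End Gentle.

(** * Gentle functions: convolution around the origin *)

Section GentleGap.
Context (R : realFieldType) (M : nat) (b : R) (f r : nat -> R).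
Hypotheses (M0 : (0 < M)%N) (b02 : 0 <= b <= 2).
Hypotheses (f00 : 0 < f 0%N) (fr : gentle_ratio b f r).

Local Notation u k := (1 - r k).
Let b0 : 0 <= b. Proof. by case/andP: b02. Qed.
Let fp : forall k, 0 <= f k. Proof. exact: gentle_ge0 f00 fr. Qed.
Let fd : forall k, f k.+1 <= f k. Proof. exact: gentle_decr f00 fr. Qed.
Let fu k : f k - f k.+1 = f k * u k.
Proof. by case: fr => fE _ _ _; rewrite fE; ring. Qed.
Let u0 k : 0 <= u k. Proof. by rewrite subr_ge0 (ratio_le1 fr). Qed.
Let u00 : u 0%N <= b / 2.
Proof. by case: fr => _ _ _; lra. Qed.
Let uS k : f k.+1 * u k.+1 <= f k.+1 * (u k + b).
Proof. by rewrite ler_wpM2l //; case: fr => _ _ /(_ k) h _; lra. Qed.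

(* Telescoping sum of f (k+1) (u (k+1) - u k) <= b f (k+1), as is slope_excess. *)
Lemma slope_square N :
  f N * u N + \sum_(j < N) f j * u j ^+ 2 <= b * (f 0%N / 2 + \sum_(j < N) f j.+1).
Proof.
elim: N => [|N IH]; first by rewrite !big_ord0; have := ler_wpM2l (fp 0) u00; lra.
rewrite !big_ord_recr /=; have := fu N; have := uS N; move: IH; rewrite expr2.
have -> : f N.+1 * (u N + b) = (f N - f N * u N) * u N + b * f N.+1.
  by rewrite -fu; ring.
lra.
Qed.

Lemma slope_excess m :
  f m * u m + f 0%N * (b / 2 - u 0%N) <= b * (f 0%N / 2 + \sum_(j < m) f j.+1).
Proof.
elim: m => [|m IH]; first by rewrite !big_ord0; lra.
rewrite !big_ord_recr /=; have := uS m; move: IH.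
have : f m.+1 * u m <= f m * u m by rewrite ler_wpM2r.
lra.
Qed.

(** Either [u 0 <= b / 4], and the linear part is at least [b / 4 >= b ^+ 2 / 8], or [u 0 ^+ 2]
    exceeds [b ^+ 2 / 16]. *)
Lemma slope_gain : b ^+ 2 / 16 <= b / 2 - u 0%N + u 0%N ^+ 2.
Proof.
have := u00; move: (u 0%N) => x xb.
have bb : b ^+ 2 <= 2 * b by rewrite expr2 ler_wpM2r //; case/andP: b02.
have [small|big] := lerP x (b / 4); first by have := sqr_ge0 x; lra.
have : (b / 4) * (b / 4) <= x * x by apply: ler_pM; lra.
by rewrite !expr2; lra.
Qed.

Let n : R := M.*2.+1%:R.
Let c : R := b ^+ 2 / (16 * n ^+ 2).

Lemma slope_gain_conv k : c * conv M f k <= f 0%N * (b / 2 - u 0%N + u 0%N ^+ 2).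
Proof.
apply: (@le_trans _ _ (f 0%N * (b ^+ 2 / 16))); last by rewrite ler_wpM2l // slope_gain.
have n1 : 1 <= n by rewrite /n ler1n.
have c0 : 0 <= c by rewrite /c divr_ge0 ?sqr_ge0 // mulr_ge0 ?sqr_ge0.
apply: le_trans (ler_wpM2l c0 (conv_le M k fd)) _; rewrite -/n.
have -> : c * (n * f 0%N) = f 0%N * (b ^+ 2 / 16) / n by rewrite /c; field; lra.
by rewrite ler_pdivrMr ?ler_peMr // ?mulr_ge0 ?sqr_ge0 //; lra.
Qed.

(** Sliding the folded window changes it at both ends, which brings the numerator to the form
    [A * E + P ^+ 2]. Cauchy-Schwarz gives [P ^+ 2 <= A * Q], and [slope_square] plus [slope_excess]
    bound [E + Q] by [b * S] less the gain. *)
Lemma low_gap k : (k < M)%N ->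
  0 <= conv M f k.+1 ^+ 2 - conv M f k * conv M f k.+2 <=
  (b - c) * (conv M f k.+1 * conv M f k).
Proof.
move=> kM; pose m := (M - k.+1)%N; pose N := (k.+1 + M)%N.
set S := conv M f k.+1; set A := conv M f k.
pose P := f m.+1 - f N; pose E := f m * u m + f N * u N.
have SE : S = \sum_(i < N.+1) f i + \sum_(i < m) f i.+1 by rewrite /S conv_low.
have AE : A = \sum_(i < N) f i + \sum_(i < m.+1) f i.+1.
  rewrite /A conv_low ?(ltnW kM) //.
  by rewrite (_ : (M - k)%N = m.+1) // /m; lia.
have AS : A = S + P.
  rewrite /S convS -/A /P (_ : absz _ = m.+1); last by rewrite /m; lia.
  by rewrite -[(k + M).+1]/N; ring.
have TS : conv M f k.+2 = S - E - P.
  rewrite convS -/S (_ : absz _ = m); last by rewrite /m; lia.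
  rewrite -[(k.+1 + M).+1]/N.+1 /E /P -!fu; ring.
have GE : S ^+ 2 - A * conv M f k.+2 = A * E + P ^+ 2 by rewrite TS AS; ring.
rewrite GE.
have mN : (m.+1 <= N)%N by rewrite /m /N; lia.
have P0 : 0 <= P by rewrite subr_ge0 decr_le.
have A0 : 0 <= A by exact: conv_ge0.
have S0 : 0 <= S by exact: conv_ge0.
have E0 : 0 <= E by rewrite addr_ge0 ?mulr_ge0.
rewrite addr_ge0 ?mulr_ge0 ?sqr_ge0 //=.
have PE : P = \sum_(m.+1 <= j < N) f j * u j.
  transitivity (\sum_(m.+1 <= j < N) (- f j.+1 - - f j)).
    by rewrite (telescope_sumr (fun j => - f j)) // opprK addrC.
  by apply: eq_bigr => j _; rewrite opprK addrC fu.
pose F := \sum_(m.+1 <= j < N) f j.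
pose Q := \sum_(m.+1 <= j < N) f j * u j ^+ 2.
have FA : F <= A.
  rewrite AE -(big_mkord xpredT f) (@big_cat_nat _ _ _ m.+1) //= -/F.
  by rewrite addrAC lerDr addr_ge0 ?sumr_ge0 // => i _; exact: fp.
have QQ : Q + f 0%N * u 0%N ^+ 2 <= \sum_(j < N) f j * u j ^+ 2.
  rewrite -(big_mkord xpredT (fun j => f j * u j ^+ 2)) (@big_cat_nat _ _ _ m.+1) //= -/Q.
  rewrite [leLHS]addrC; apply: lerD => //; rewrite big_nat_recl // lerDl sumr_ge0 // => i _.
  by rewrite mulr_ge0 ?sqr_ge0.
have Q0 : 0 <= Q by apply: sumr_ge0 => i _; rewrite mulr_ge0 ?sqr_ge0.
have PQ : P ^+ 2 <= A * Q.
  have [Az|Apos] := leP A 0.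
    have Pz : P = 0 by apply/eqP; rewrite eq_le P0 andbT; move: AS S0 Az; lra.
    by rewrite Pz expr0n mulr_ge0.
  have sq : 0 <= \sum_(m.+1 <= j < N) f j * (A * u j - P) ^+ 2.
    by apply: sumr_ge0 => j _; rewrite mulr_ge0 ?sqr_ge0.
  have sqE : \sum_(m.+1 <= j < N) f j * (A * u j - P) ^+ 2 =
    A ^+ 2 * Q - 2 * A * P * P + P ^+ 2 * F.
    transitivity (\sum_(m.+1 <= j < N)
        (A ^+ 2 * (f j * u j ^+ 2) - 2 * A * P * (f j * u j) + P ^+ 2 * f j)).
      by apply: eq_bigr => j _; ring.
    by rewrite big_split sumrB -!mulr_sumr -PE.
  rewrite -(ler_pM2l Apos).
  have := ler_wpM2l (sqr_ge0 P) FA.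
  move: sq; rewrite sqE !expr2; lra.
have main : E + (f 0%N * (b / 2 - u 0%N + u 0%N ^+ 2) + Q) <= b * S.
  have SE' : S = f 0%N + \sum_(i < N) f i.+1 + \sum_(i < m) f i.+1.
    by rewrite SE big_ord_recl.
  have := slope_square N; have := slope_excess m.
  by rewrite SE' /E; lra.
have gain := slope_gain_conv k.+1; rewrite -/S in gain.
have : A * (E + Q) <= A * (b * S - c * S) by rewrite ler_wpM2l //; lra.
lra.
Qed.

(** Both slope inequalities are taken up to [M]; their sum has [2 * (f M * u M)] on the left and
    [b * conv M f 0] on the right, whence the halved constant. *)
Lemma zero_gap : 0 <= conv M f 0 - conv M f 1 <= (b - c) / 2 * conv M f 0.
Proof.
have D : conv M f 0 - conv M f 1 = f M * u M.
  by rewrite (convS _ _ 0) add0n (_ : absz _ = M) -?fu; [ring|lia].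
rewrite D mulr_ge0 //=.
have := slope_square M; have := slope_excess M; have := slope_gain_conv 0.
have : f 0%N * u 0%N ^+ 2 <= \sum_(j < M) f j * u j ^+ 2.
  case: (M) M0 => // M' _; rewrite big_ord_recl /= lerDl sumr_ge0 // => i _.
  by rewrite mulr_ge0 ?sqr_ge0.
have -> : conv M f 0 = f 0%N + \sum_(i < M) f i.+1 + \sum_(i < M) f i.+1.
  by rewrite conv_low // add0n subn0 big_ord_recl.
lra.
Qed.

End GentleGap.

(** * Gentle functions: series law *)

Section GentleConvolution.
Context (R : realFieldType) (M : nat).
Hypothesis M0 : (0 < M)%N.

Definition gain : R := (16 * M.*2.+1%:R ^+ 2)^-1.

Lemma gentle_conv (b : R) f : 0 <= b <= 2 -> gentle b f ->
  gentle (b - gain * b ^+ 2) (conv M f).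
Proof.
move=> b02 [f00 [r fr]]; have b0 : 0 <= b by case/andP: b02.
have fp := gentle_ge0 f00 fr; have fd := gentle_decr f00 fr.
have cd := conv_decr M fd; have cp k := conv_ge0 M k fp.
have c0 := conv_gt0 M fp f00.
pose n : R := M.*2.+1%:R; pose c := b - b ^+ 2 / (16 * n ^+ 2).
have gap k : 0 <= conv M f k.+1 ^+ 2 - conv M f k * conv M f k.+2 <=
  c * (conv M f k.+1 * conv M f k).
  have [kM|Mk] := ltnP k M.
    exact: (low_gap M0 b02 f00 fr kM).
  have [M' ME] : exists M', M.*2.+1 = M'.+2 by exists M.*2.-1; lia.
  have r01 i : 0 <= r i <= 1 by rewrite (ratio_le1 fr) andbT; case: fr.
  case: fr => fE _ rb _.
  have := @high_gap _ M' b (fun i => f (k - M + i)%N) (fun i => r (k - M + i)%N) b02.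
  rewrite -ME -/n -/c => /(_ (fun i => fp _) _ (fun i => r01 _)) gap.
  rewrite !conv_high //; try exact: leqW; last exact/leqW/leqW.
  have E1 : \sum_(j < M.*2.+1) f (k.+1 - M + j)%N = \sum_(j < M.*2.+1) f (k - M + j.+1)%N.
    by apply: eq_bigr => j _; congr f; lia.
  have E2 : \sum_(j < M.*2.+1) f (k.+2 - M + j)%N = \sum_(j < M.*2.+1) f (k - M + j.+2)%N.
    by apply: eq_bigr => j _; congr f; lia.
  by rewrite E1 E2; apply: gap => i; rewrite addnS // fE.
have cE : b - gain * b ^+ 2 = c by rewrite /c /gain mulrC.
have zero := zero_gap M0 b02 f00 fr; rewrite -/n -/c in zero.
have cp0 : 0 <= c.
  by have /andP[z1 z2] := zero; have := le_trans z1 z2; rewrite pmulr_lge0 //; lra.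
(* Once the convolution vanishes it stays zero, and the quotient by zero is 0 there. *)
rewrite cE; split => //; exists (fun k => conv M f k.+1 / conv M f k); split.
- move=> k; have [z|nz] := eqVneq (conv M f k) 0; last by rewrite divfK.
  by apply/eqP; rewrite z mulr0 eq_le cp andbT -z.
- by move=> k; rewrite divr_ge0.
- move=> k; have [z|nz] := eqVneq (conv M f k.+1) 0.
    by rewrite z invr0 mulr0 mul0r lexx add0r.
  have S0 : 0 < conv M f k.+1 by rewrite lt_neqAle eq_sym nz cp.
  have A0 : 0 < conv M f k := lt_le_trans S0 (cd k).
  have SA0 : 0 < conv M f k.+1 * conv M f k by rewrite mulr_gt0.
  have /andP[g1 g2] := gap k.
  have D : conv M f k.+1 / conv M f k - conv M f k.+2 / conv M f k.+1 =
    (conv M f k.+1 ^+ 2 - conv M f k * conv M f k.+2) / (conv M f k.+1 * conv M f k).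
    by field; rewrite !gt_eqF.
  apply/andP; split; first by rewrite -subr_ge0 D divr_ge0 // ltW.
  by rewrite -lerBlDl D ler_pdivrMr.
- rewrite ler_pdivrMr // mul1r cd andbT.
  by rewrite ler_pdivlMr //; move: zero; lra.
Qed.

End GentleConvolution.

(** * Summing out increments on a finite rooted tree *)

Section RootedTree.
Context (R : realFieldType) (M : nat) (T : finType) (v : T) (par : T -> T).
Context (d : T -> nat) (bd : pred T).
Hypothesis dv : d v = 0%N.
Hypothesis d_par : forall x, x != v -> d x = (d (par x)).+1.
Hypothesis bd_leaf : forall x, x != v -> ~~ bd (par x).

Definition child x : pred T := [pred c | (c != v) && (par c == x)].

Lemma child_depth x c : child x c -> d c = (d x).+1.
Proof. by case/andP=> cv /eqP <-; apply: d_par. Qed.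

Definition codepth (x : T) : nat := (\max_y d y - d x)%N.

Lemma child_codepth x c : child x c -> codepth x = (codepth c).+1.
Proof.
move=> /child_depth dc; rewrite /codepth; have := @leq_bigmax T d c.
by rewrite dc; move: (\max_y d y) (d x) => a b; clear dv; lia.
Qed.

Lemma tree_ind (P : T -> Prop) :
  (forall x, (forall c, child x c -> P c) -> P x) -> forall x, P x.
Proof.
move=> IH x; have [n] := ubnP (codepth x).
elim: n x => // n IHn x lt; apply: IH => c cx; apply: IHn.
by move: lt; rewrite (child_codepth cx).
Qed.

(** Fuel [codepth x + 1] suffices: [F x] reads its argument only at children, whose codepth is one
    less. *)
Lemma tree_rec (A : Type) (F : T -> (T -> A) -> A) :
  (forall x g h, (forall c, child x c -> g c = h c) -> F x g = F x h) ->
  A -> exists f : T -> A, forall x, f x = F x f.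
Proof.
move=> F_ext a0.
pose fix f n (x : T) {struct n} : A := if n is n'.+1 then F x (f n') else a0.
exists (fun x => f (codepth x).+1 x) => x; apply: F_ext => c cx.
by rewrite (child_codepth cx).
Qed.

Fixpoint subtree_weight n (x : T) (k : nat) : R :=
  if bd x then (k == 0)%:R else
  if n is n'.+1 then \prod_(c | child x c) conv M (subtree_weight n' c) k else 1.

(* The number of Lipschitz functions on the subtree of x that take the
   value k at x and vanish on bd. *)
Definition weight (x : T) : nat -> R := subtree_weight (codepth x).+1 x.

Lemma weightE x k : weight x k =
  if bd x then (k == 0)%:R else \prod_(c | child x c) conv M (weight c) k.
Proof.
rewrite /weight /=; case: ifP => // _; apply: eq_bigr => c cx.
by rewrite (child_codepth cx).
Qed.

Local Notation incr := {ffun T -> 'I_M.*2.+1}.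

Fixpoint pos_rec (eta : incr) (k : int) n (x : T) : int :=
  if n is n'.+1 then pos_rec eta k n' (par x) + (eta x)%:Z - M%:Z else k.

(* The function with value k at the root and increments eta - M along edges. *)
Definition pos (eta : incr) (k : int) (x : T) : int := pos_rec eta k (d x) x.

Lemma pos_root eta k : pos eta k v = k.
Proof. by rewrite /pos dv. Qed.

Lemma pos_step eta k x : x != v ->
  pos eta k x = pos eta k (par x) + (eta x)%:Z - M%:Z.
Proof. by move=> xv; rewrite /pos d_par. Qed.

Definition update (eta : incr) y t : incr := [ffun x => if x == y then t else eta x].

Lemma pos_update eta k y t x : x != y -> (d x <= d y)%N ->
  pos (update eta y t) k x = pos eta k x.
Proof.
have [n] := ubnP (d x); elim: n x => // n IH x lt xy xd.
have [->|xv] := eqVneq x v; first by rewrite !pos_root.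
rewrite (pos_step _ _ xv) (pos_step eta k xv) ffunE (negPf xy); have dx := d_par xv.
congr (_ + _ - _); apply: IH; [lia| |lia].
by apply/eqP => e; move: dx; rewrite e; lia.
Qed.

(** Exchanging [t] with [eta y] is an involution on the pairs [(eta, t)]. *)
Lemma sum_update (G : incr -> R) y :
  \sum_eta \sum_t G (update eta y t) = M.*2.+1%:R * \sum_eta G eta.
Proof.
pose h (p : incr * 'I_M.*2.+1) := (update p.1 y p.2, p.1 y).
have hK : involutive h.
  case=> eta t; rewrite /h /= ffunE eqxx; congr pair.
  by apply/ffunP => x; rewrite !ffunE; case: eqVneq => // ->.
rewrite pair_big (reindex_inj (inv_inj hK)) /=.
transitivity (\sum_(p : incr * 'I_M.*2.+1) G p.1).
  by apply: eq_bigr => p _; congr G; rewrite -[in RHS](hK p).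
rewrite -(pair_big xpredT xpredT (fun e _ => G e)) /= mulr_sumr.
by apply: eq_bigr => eta _; rewrite sumr_const card_ord mulr_natl.
Qed.

(** The factor of [x] once the subtrees of its children outside [Y] have been summed out. *)
Definition partial_weight (Y : {set T}) x j : R :=
  (if bd x then (j == 0)%:R else 1) *
  \prod_(c | child x c && (c \notin Y)) conv M (weight c) j.

(* The vertices outside Y are already summed out, deepest first; unused
   increments only contribute a factor independent of k. *)
Definition config_sum (Y : {set T}) (k : int) : R :=
  \sum_(eta : incr) (eta v == ord0)%:R *
     \prod_(x in Y) partial_weight Y x `|pos eta k x|%N.

Lemma partial_weight_leaf (Y : {set T}) x j :
  (forall c, child x c -> c \notin Y) -> partial_weight Y x j = weight x j.
Proof.
move=> xY; rewrite /partial_weight weightE; case: ifP => bx; last first.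
  by rewrite mul1r; apply: eq_bigl => c; case cx : (child x c); rewrite //= xY.
rewrite big_pred0 ?mulr1 // => c; apply/negP => /andP[/andP[cv /eqP px] _].
by move: (bd_leaf cv); rewrite px bx.
Qed.

(** As [y] is deepest, no other vertex of [Y] feels its increment. Summing over that increment turns
    the factor of [y] into [conv M (weight y)] at the height of its parent, where it joins the
    partial weight. The factor [2M + 1] pays for the free increment left at [y]. *)
Lemma config_sum_prune (Y : {set T}) y k : v \in Y -> y \in Y -> y != v ->
  (forall x, x \in Y -> x != v -> par x \in Y) ->
  (forall x, x \in Y -> (d x <= d y)%N) ->
  M.*2.+1%:R * config_sum Y k = config_sum (Y :\ y) k.
Proof.
move=> vY yY yv closed deepest; rewrite /config_sum -(sum_update _ y).
apply: eq_bigr => eta _.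
have py : par y != y by apply/eqP => e; have := d_par yv; rewrite e; lia.
have pY : par y \in Y :\ y by rewrite !inE py closed.
transitivity (\sum_(t < M.*2.+1) (eta v == ord0)%:R *
   ((\prod_(x in Y :\ y) partial_weight Y x `|pos eta k x|%N) *
   weight y `|(pos eta k (par y) + (nat_of_ord t)%:Z - M%:Z)%R|%N)).
  apply: eq_bigr => t _; rewrite ffunE (negbTE (_ : v != y)) 1?eq_sym //; congr (_ * _).
  rewrite (big_setD1 y) //= mulrC; congr (_ * _).
    apply: eq_bigr => x; rewrite !inE => /andP[xy xY].
    by rewrite pos_update ?deepest.
  rewrite partial_weight_leaf; last first.
    move=> c cy; apply/negP => /deepest; rewrite (child_depth cy); lia.
  rewrite pos_step // ffunE eqxx pos_update ?(d_par yv) //.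
rewrite -mulr_sumr -mulr_sumr conv_norm; congr (_ * _).
rewrite (bigD1 (par y)) //= [RHS](bigD1 (par y)) //= mulrAC; congr (_ * _).
  rewrite /partial_weight -mulrA; congr (_ * _).
  rewrite [RHS](bigD1 y) /=; last by rewrite /child /= yv !inE !eqxx.
  rewrite mulrC; congr (_ * _); apply: eq_bigl => c; rewrite !inE.
  case: (eqVneq c y) => [->|cy] /=; rewrite ?yY /= ?andbF ?andbT //.
apply: eq_bigr => x /andP[]; rewrite !inE => /andP[xy xY] xp.
congr (_ * _); apply: eq_bigl => c; rewrite !inE.
have xy0 : child x y = false by rewrite /child /= [par y == x]eq_sym (negPf xp) andbF.
by case: (eqVneq c y) => [->|cy] //=; rewrite xy0.
Qed.

Lemma config_sum_root (m : nat) (Y : {set T}) k : v \in Y -> #|Y| = m.+1 ->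
  (forall x, x \in Y -> x != v -> par x \in Y) ->
  M.*2.+1%:R ^+ m * config_sum Y k = config_sum [set v] k.
Proof.
elim: m Y => [|m IH] Y vY cardY closed.
  rewrite mul1r; have /cards1P[z Yz] : #|Y| == 1%N by rewrite cardY.
  by move: vY; rewrite Yz !inE => /eqP ->.
pose y := [arg max_(x > v in Y) d x].
have [yY deepest] : y \in Y /\ forall x, x \in Y -> (d x <= d y)%N.
  by rewrite /y; case: arg_maxnP.
have yv : y != v.
  apply/eqP => yv.
  have : Y \subset [set v].
    apply/fintype.subsetP => x xY; rewrite inE; apply/negPn/negP => xv.
    by have := deepest x xY; rewrite (d_par xv) yv dv.
  by move/subset_leq_card; rewrite cards1 cardY.
rewrite exprSr -mulrA (config_sum_prune k vY yY) //; apply: IH.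
- by rewrite !inE eq_sym yv.
- by move: cardY; rewrite (cardsD1 y) yY => -[].
- move=> x; rewrite !inE => /andP[xy xY] xv; rewrite closed // andbT.
  by apply/eqP => e; have := deepest x xY; rewrite (d_par xv) e; lia.
Qed.

Definition root_configs : R := \sum_(eta : incr) (eta v == ord0)%:R.

Lemma root_configs_gt0 : 0 < root_configs.
Proof.
rewrite /root_configs (bigD1 [ffun=> ord0]) //= ffunE eqxx.
by rewrite ltr_pwDl ?ltr01 // sumr_ge0.
Qed.

(** Independent of the root value, hence it cancels in [height_law]. *)
Definition tree_const : R := root_configs / M.*2.+1%:R ^+ #|T|.-1.

Lemma tree_const_gt0 : 0 < tree_const.
Proof. by rewrite divr_gt0 ?root_configs_gt0 ?exprn_gt0. Qed.

(** With [Y] the whole tree the factors are boundary indicators; with [Y] the root alone only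
    [weight v] is left. [config_sum_root] links the two. *)
Lemma count_configs k :
  \sum_(eta : incr) ((eta v == ord0) && [forall x, bd x ==> (pos eta k x == 0)])%:R
  = tree_const * weight v `|k|%N.
Proof.
have T0 : (0 < #|T|)%N by apply/card_gt0P; exists v.
have := @config_sum_root #|T|.-1 [set: T] k (finset.in_setT v).
rewrite cardsT prednK // => /(_ erefl (fun x _ _ => finset.in_setT _)) E.
have -> : \sum_(eta : incr) ((eta v == ord0) &&
    [forall x, bd x ==> (pos eta k x == 0)])%:R = config_sum [set: T] k.
  apply: eq_bigr => eta _; rewrite -mulnb natrM; congr (_ * _).
  rewrite (eq_bigr (fun x => (bd x ==> (pos eta k x == 0))%:R)); last first.
    move=> x _; rewrite /partial_weight big_pred0 ?mulr1; last first.
      by move=> c; rewrite finset.in_setT andbF.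
    by rewrite absz_eq0; case: (bd x).
  rewrite (eq_bigl xpredT); last by move=> x; rewrite finset.in_setT.
  case: forallP => [h|/forallP]; first by rewrite big1 // => x _; rewrite h.
  rewrite negb_forall => /existsP[x hx].
  by rewrite (bigD1 x) //= (negPf hx) mul0r.
have n0 : M.*2.+1%:R ^+ #|T|.-1 != 0 :> R by rewrite expf_neq0 ?pnatr_eq0.
apply: (mulfI n0); rewrite E /tree_const.
have cancel (x y z : R) : x != 0 -> x * (y / x * z) = y * z by move=> x0; field.
rewrite (cancel _ _ _ n0).
rewrite /config_sum /root_configs mulr_suml; apply: eq_bigr => eta _.
rewrite big_set1 pos_root partial_weight_leaf // => c cv.
by rewrite inE; case/andP: cv.
Qed.

End RootedTree.

Local Open Scope classical_set_scope.
Local Open Scope ring_scope.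

(** * Lipschitz functions as increment configurations *)

Section CountLipschitz.
Context (R : realFieldType) (M : nat) (T : finType) (v : T) (par : T -> T).
Context (d : T -> nat) (bd : pred T).
Hypothesis dv : d v = 0%N.
Hypothesis d_par : forall x, x != v -> d x = (d (par x)).+1.
Hypothesis bd_leaf : forall x, x != v -> ~~ bd (par x).

Definition tree_lipschitz (B : set int) : set {ffun T -> int} :=
  [set phi : {ffun T -> int} |
    [/\ forall x, x != v -> `|phi x - phi (par x)| <= M%:Z,
        forall x, bd x -> phi x = 0 & B (phi v)]].

Variable B0 : nat.
Hypothesis root_bound : forall phi, tree_lipschitz setT phi -> `|phi v| <= B0%:Z.

Local Notation pos := (@pos M T par d).
Let config : finType := ('I_B0.*2.+1 * {ffun T -> 'I_M.*2.+1})%type.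
Let root_value (p : config) : int := (nat_of_ord p.1)%:Z - B0%:Z.
Let config_fun (p : config) : {ffun T -> int} := [ffun x => pos p.2 (root_value p) x].

(** Fixing the increment stored at the root makes the encoding injective. *)
Let good (B : set int) (p : config) : bool :=
  ((p.2 v == ord0) && [forall x, bd x ==> (pos p.2 (root_value p) x == 0)]) &&
  `[< B (root_value p) >].

Let config_fun_inj B : {in good B &, injective config_fun}.
Proof.
move=> [i eta] [j zeta] /andP[/andP[/eqP /= ev _] _] /andP[/andP[/eqP /= zv _] _] E.
have pE x : pos eta (root_value (i, eta)) x = pos zeta (root_value (j, zeta)) x.
  by move/ffunP: E => /(_ x); rewrite !ffunE.
have := pE v; rewrite !(pos_root _ dv) /root_value /= => ij.
congr pair; first by apply: val_inj => /=; lia.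
apply/ffunP => x; have [->|xv] := eqVneq x v; first by rewrite ev zv.
have := pE x; rewrite !(pos_step d_par _ _ xv) pE => h.
by apply: val_inj => /=; lia.
Qed.

Let config_fun_good B p : good B p -> tree_lipschitz B (config_fun p).
Proof.
move=> /andP[/andP[_ /forallP bp] /asboolP Bp]; split.
- move=> x xv; rewrite !ffunE (pos_step d_par _ _ xv).
  move: (pos p.2 _ _) (ltn_ord (p.2 x)) => a; move: (p.2 x : nat) => c; lia.
- by move=> x bx; rewrite ffunE; apply/eqP; have := bp x; rewrite bx.
- by rewrite ffunE pos_root.
Qed.

Let config_fun_surj B phi : tree_lipschitz B phi ->
  exists2 p, good B p & config_fun p = phi.
Proof.
move=> [lip zero Bphi].
have bound : `|phi v| <= B0%:Z by apply: root_bound; split.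
pose i : 'I_B0.*2.+1 := inord (absz (phi v + B0%:Z)).
pose eta := [ffun x => if x == v then ord0 else
  inord (absz (phi x - phi (par x) + M%:Z)) : 'I_M.*2.+1].
have iE : root_value (i, eta) = phi v.
  by rewrite /root_value /= inordK; lia.
have posE x : pos eta (phi v) x = phi x.
  have [n] := ubnP (d x); elim: n x => // n IH x lt.
  have [->|xv] := eqVneq x v; first by rewrite pos_root.
  have lx := lip x xv.
  rewrite (pos_step d_par _ _ xv) IH; last by rewrite (d_par xv) in lt.
  by rewrite ffunE (negPf xv) inordK; lia.
exists (i, eta); last by apply/ffunP => x; rewrite ffunE iE posE.
apply/andP; split; last by rewrite iE; apply/asboolP.
rewrite iE ffunE eqxx /=; apply/forallP => x; apply/implyP => bx.
by rewrite posE zero.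
Qed.

Lemma card_tree_lipschitz (B : set int) : finite_set (tree_lipschitz B) /\
  #|` fset_set (tree_lipschitz B) |%:R = tree_const R M v *
    \sum_(i < B0.*2.+1) (if `[< B ((nat_of_ord i)%:Z - B0%:Z) >]
      then weight R M v par d bd v `|((nat_of_ord i)%:Z - B0%:Z)%R|%N else 0).
Proof.
pose s := [seq config_fun p | p <- enum (good B)].
have sE : tree_lipschitz B = [set` [fset x in s]%fset].
  apply/seteqP; split => phi /=.
    move=> /config_fun_surj[p gp <-].
    by rewrite !inE; apply/mapP; exists p => //; rewrite mem_enum.
  rewrite !inE => /mapP[p]; rewrite mem_enum => gp ->.
  exact: config_fun_good.
have us : uniq s.
  rewrite map_inj_in_uniq ?enum_uniq // => p q; rewrite !mem_enum.
  exact: config_fun_inj.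
split; first by rewrite sE; exact: finite_fset.
rewrite sE set_fsetK card_fseq undup_id // size_map -cardE.
rewrite -sum1_card natr_sum big_mkcond /=.
rewrite -(pair_big xpredT xpredT (fun i eta => if (i, eta) \in good B then 1 else 0)) /=.
rewrite mulr_sumr; apply: eq_bigr => i _.
have [Bi|nBi] := boolP `[< B _ >].
  rewrite -(count_configs R M dv d_par bd_leaf); apply: eq_bigr => eta _.
  by rewrite unfold_in /good Bi andbT; case: (_ && _).
rewrite mulr0 big1 // => eta _.
by rewrite unfold_in /good (negPf nBi) andbF.
Qed.

End CountLipschitz.

(** * Rooting a tree at a vertex *)

Section RootedGraph.
Context (V : choiceType) (e : rel V) (te : is_tree e) (v : V).

Let e_sym : symmetric e := tree_sym te.

Let walk_of_length x n := `[< exists p, [/\ path e v p, last v p = x & size p = n] >].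

Let walk_exists x : exists n, walk_of_length x n.
Proof.
have [p pv px] := tree_connected te v x.
by exists (size p); apply/asboolP; exists p.
Qed.

Definition depth x : nat := ex_minn (walk_exists x).

Lemma depth_path x : exists p, [/\ path e v p, last v p = x & size p = depth x].
Proof. by rewrite /depth; case: ex_minnP => n /asboolP. Qed.

Lemma depth_le p : path e v p -> (depth (last v p) <= size p)%N.
Proof.
by move=> vp; rewrite /depth; case: ex_minnP => n _; apply; apply/asboolP; exists p.
Qed.

Lemma depth_root : depth v = 0%N.
Proof. by apply/eqP; rewrite -leqn0; apply: (@depth_le [::]). Qed.

Lemma depth_eq0 x : depth x = 0%N -> x = v.
Proof. by have [p [_ <- <-]] := depth_path x => /size0nil ->. Qed.

Lemma lower_neighbour x : x != v -> exists y, e x y /\ depth x = (depth y).+1.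
Proof.
have [p [vp px sp]] := depth_path x; case/lastP: p vp px sp => [|p z].
  by move=> _ /= -> ; rewrite eqxx.
rewrite rcons_path last_rcons size_rcons => /andP[vp ez] zx sp _; subst z.
exists (last v p); split; first by rewrite e_sym.
have := depth_le vp; have [q [vq qp sq]] := depth_path (last v p).
have : path e v (rcons q x) by rewrite rcons_path vq qp.
by move/depth_le; rewrite last_rcons size_rcons; lia.
Qed.

Definition parent x : V := xget v [set y | e x y /\ depth x = (depth y).+1].

Lemma parentP x : x != v -> e x (parent x) /\ depth x = (depth (parent x)).+1.
Proof. by move=> /lower_neighbour ex; apply: (xgetPex v ex). Qed.

Definition linked_avoiding x a b : Prop :=
  exists p, [/\ path e a p, last a p = b & x \notin a :: p].

Lemma linked_trans x a b c :
  linked_avoiding x a b -> linked_avoiding x b c -> linked_avoiding x a c.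
Proof.
move=> [p [ap pb xp]] [q [bq qc xq]]; exists (p ++ q); split.
- by rewrite cat_path ap pb.
- by rewrite last_cat pb.
- by move: xp xq; rewrite !inE mem_cat !negb_or => /andP[-> ->] /andP[_ ->].
Qed.

Lemma linked_sym x a b : linked_avoiding x a b -> linked_avoiding x b a.
Proof.
move=> [p]; elim: p a => [|c p IH] a [ap pb xp]; first by exists [::]; rewrite -pb.
move: ap xp => /= /andP[ac cp]; rewrite inE negb_or => /andP[xa xp].
apply: (@linked_trans _ _ c); first by apply: IH.
exists [:: a]; split => //=; first by rewrite e_sym ac.
by rewrite !inE !negb_or xa; move: xp; rewrite inE negb_or => /andP[->].
Qed.

(** After [y], the chain of parents to the root has depth strictly below that of [x], so it misses
    [x]. *)
Lemma linked_root x y : y != x -> (depth y <= depth x)%N -> linked_avoiding x y v.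
Proof.
have [n] := ubnP (depth y); elim: n y => // n IH y lt yx yd.
have [->|yv] := eqVneq y v.
  exists [::]; split => //; rewrite inE; apply: contra yx => /eqP xv.
  by rewrite xv in yd *; move: yd; rewrite depth_root leqn0 => /eqP/depth_eq0 ->.
have [yp dp] := parentP yv.
have px : parent y != x by apply/eqP => px; rewrite -px in yd; lia.
apply: (@linked_trans _ _ (parent y)); last by apply: IH => //; lia.
by exists [:: parent y]; split => //=; rewrite ?yp // !inE !negb_or ![x == _]eq_sym yx px.
Qed.

(** Otherwise a simple path from [a] to [b] closes up through [x] to a cycle with at least three
    vertices. *)
Lemma no_bypass x a b : e x a -> e x b -> linked_avoiding x a b -> a = b.
Proof.
move=> xa xb [p [ap pb xp]]; apply/eqP/negPn/negP => ab.
case/shortenP: ap pb xp => q aq uq sub qb xp.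
apply: (@tree_acyclic _ _ te (x :: a :: q)).
  by case: q aq uq sub qb => //= _ _ _ E; rewrite E eqxx in ab.
rewrite /ucycle /=; apply/andP; split.
  by rewrite xa /= rcons_path aq qb e_sym xb.
rewrite andbA -andbA; move: uq => /= ->; rewrite andbT.
by apply: contra xp; rewrite !inE => /orP[->//|/sub ->]; rewrite orbT.
Qed.

Lemma parent_unique x y : e x y -> (depth y <= depth x)%N -> x != v /\ y = parent x.
Proof.
move=> xy yd; have ne z : e x z -> z != x.
  by move=> xz; apply/eqP => zx; move: xz; rewrite zx (tree_irr te).
have xv : x != v.
  apply/eqP => xv; have := ne _ xy; rewrite xv in yd *.
  by move: yd; rewrite depth_root leqn0 => /eqP/depth_eq0 ->; rewrite eqxx.
split => //; have [xp dp] := parentP xv; apply: (no_bypass xy xp).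
apply: (@linked_trans _ _ v); first by apply: linked_root => //; exact: ne.
by apply: linked_sym; apply: linked_root; [exact: ne|lia].
Qed.

Lemma edge_parent x y : e x y -> (x != v /\ y = parent x) \/ (y != v /\ x = parent y).
Proof.
move=> xy; have [yx|/ltnW xd] := leqP (depth y) (depth x).
  by left; apply: parent_unique.
by right; apply: parent_unique; rewrite // e_sym.
Qed.

(** A step of the walk either goes from a parent to its child, or returns to the parent of the last
    vertex, which was visited before. *)
Lemma path_parent p z : path e v p -> z \in v :: p -> z != v -> parent z \in v :: p.
Proof.
elim/last_ind: p z => [|p x IH] z; first by rewrite inE => _ /eqP ->; rewrite eqxx.
rewrite rcons_path => /andP[vp px]; rewrite -rcons_cons !mem_rcons !inE.
have lp : last v p \in v :: p by rewrite mem_last.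
have old z' : z' \in v :: p -> z' != v ->
    [|| parent z' == x, parent z' == v | parent z' \in p].
  by move=> zp zv; have := IH z' vp zp zv; rewrite inE => ->; rewrite orbT.
move=> /predU1P[->|zp]; last by apply: old; rewrite inE.
move=> xv; have [[lv xE]|[_ <-]] := edge_parent px.
  by apply: old => //; rewrite xE; apply: IH.
by move: lp; rewrite inE => ->; rewrite orbT.
Qed.

(** * Finite domains and their boundary *)

Section Domain.
Context (lf : locally_finite e) (L : {fset V}).
Hypotheses (cL : connected_in e L) (vL : v \in L).

Lemma bdryP u : reflect (u \notin L /\ exists2 w, w \in L & e w u) (u \in bdry e L).
Proof.
rewrite /bdry in_fset_set; last first.
  apply: (@sub_finite_set _ _ (\bigcup_(w in [set` L]) [set y | e w y])).
    by move=> x /= [_ [w wL wx]]; exists w.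
  by apply: bigcup_finite => // w _; exact: lf.
by apply: (iffP idP); rewrite inE.
Qed.

Lemma parent_inner x : x \in L -> x != v -> parent x \in L.
Proof.
move=> xL xv; have [p [vp px sp]] := cL vL xL.
have : parent x \in v :: p by apply: path_parent => //; rewrite -px mem_last.
by rewrite inE => /predU1P[->//|/sp].
Qed.

Lemma parent_domain x : x \in (L `|` bdry e L)%fset -> x != v -> parent x \in L.
Proof.
rewrite inE => /orP[xL|/bdryP[xL [w wL wx]]] xv; first exact: parent_inner.
have [[wv xE]|[_ <-]//] := edge_parent wx.
by move: xL; rewrite xE parent_inner.
Qed.

Lemma neighbour_domain x y : x \in L -> e x y -> y \in (L `|` bdry e L)%fset.
Proof.
move=> xL xy; rewrite inE; have [//|yL] := boolP (y \in L).
by apply/bdryP; split => //; exists x.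
Qed.

(** Climbing from [z] to the root must enter [L], and the vertex just before that is on the
    boundary. *)
Lemma bdry_below z : z \notin L ->
  exists2 b, b \in bdry e L & (depth b <= depth z)%N.
Proof.
have [n] := ubnP (depth z); elim: n z => // n IH z lt zL.
have zv : z != v by apply: contraNneq zL => ->.
have [zp dz] := parentP zv.
have [pL|pL] := boolP (parent z \in L).
  by exists z => //; apply/bdryP; split => //; exists (parent z); rewrite // e_sym.
by have [|b bb db] := IH _ _ pL; [lia|exists b => //; lia].
Qed.

Local Notation T := (L `|` bdry e L)%fset.

Lemma root_domain : v \in T. Proof. by rewrite inE vL. Qed.

Definition root : T := [` root_domain]%fset.

Definition tree_parent (x : T) : T := insubd root (parent (val x)).

Definition tree_depth (x : T) : nat := depth (val x).

Definition leaf : pred T := fun x => val x \in bdry e L.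

Lemma neq_root (x : T) : (x != root) = (val x != v).
Proof. by rewrite -val_eqE. Qed.

Lemma val_parent (x : T) : x != root -> val (tree_parent x) = parent (val x).
Proof.
rewrite neq_root => xv; rewrite /tree_parent val_insubd.
by rewrite inE (parent_domain (valP x) xv).
Qed.

Lemma tree_depth_root : tree_depth root = 0%N.
Proof. exact: depth_root. Qed.

Lemma tree_depth_parent (x : T) : x != root ->
  tree_depth x = (tree_depth (tree_parent x)).+1.
Proof.
move=> xr; rewrite /tree_depth val_parent //.
by rewrite neq_root in xr; case: (parentP xr).
Qed.

Lemma leafN (x : T) : ~~ leaf x -> val x \in L.
Proof. by have := valP x; rewrite inE /leaf => /orP[//|->]. Qed.

Lemma inner_leafN (x : T) : val x \in L -> ~~ leaf x.
Proof. by move=> xL; apply/negP => /bdryP[]; rewrite xL. Qed.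

Lemma leaf_parent (x : T) : x != root -> ~~ leaf (tree_parent x).
Proof.
move=> xr; apply: inner_leafN; rewrite val_parent //.
by apply: parent_domain; rewrite -?neq_root //; exact: valP.
Qed.

Lemma neighbours_perm (x : T) : val x \in L ->
  perm_eq (fset_set [set y | e (val x) y])
    ((if x == root then [::] else [:: parent (val x)]) ++
     [seq val c | c <- enum (child root tree_parent x)]).
Proof.
move=> xL; apply: uniq_perm; first exact: fset_uniq.
  rewrite cat_uniq (map_inj_uniq val_inj) enum_uniq andbT.
  have [_|xr] := eqVneq x root; rewrite /= ?andbT; first by apply/hasPn.
  apply/hasPn => y /mapP[c]; rewrite mem_enum => cx ->; rewrite inE.
  have cd : depth (val c) = (depth (val x)).+1 := child_depth tree_depth_parent cx.
  rewrite neq_root in xr; have [_ dx] := parentP xr.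
  by apply/eqP => /(congr1 depth) /=; move: cd dx => /=; lia.
move=> y; rewrite in_fset_set; last exact: lf.
rewrite mem_cat; apply/idP/idP; rewrite inE /=.
  move=> xy; have [[xv ->]|[yv xE]] := edge_parent xy.
    by rewrite -neq_root in xv; rewrite (negPf xv) inE eqxx.
  apply/orP; right; apply/mapP; exists [` neighbour_domain xL xy]%fset => //.
  have yr : [` neighbour_domain xL xy]%fset != root by rewrite neq_root.
  rewrite mem_enum; apply/andP; split => //.
  by rewrite -val_eqE /= val_parent //= -xE.
case/orP.
  case: ifPn => //; rewrite neq_root inE => xr /eqP ->.
  by case: (parentP xr).
case/mapP => c; rewrite mem_enum => /andP[cr /eqP <-] ->.
by rewrite val_parent // e_sym; rewrite neq_root in cr; case: (parentP cr).
Qed.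

Lemma neighbours_sum (W : nmodType) (x : T) (F : V -> W) : val x \in L ->
  \sum_(y <- fset_set [set y | e (val x) y]) F y =
  (if x == root then 0 else F (parent (val x))) +
  \sum_(c | child root tree_parent x c) F (val c).
Proof.
move=> xL; rewrite (perm_big _ (neighbours_perm xL)) big_cat big_map big_enum /=.
by case: ifP; rewrite ?big_nil ?big_seq1.
Qed.

End Domain.

End RootedGraph.

(** * Tails and two-sided sums *)

Section SequenceBounds.
Context (R : realFieldType).
Implicit Types (f g : nat -> R) (a b : R).

(** Beyond [M] steepness gives [a * f (i + 1) <= f i - f (i + 1)], which telescopes. *)
Lemma steep_tail M a f r n : 0 <= a -> steep M a f -> (M <= r)%N ->
  a * \sum_(i < n.+1) (if (r < i)%N then f i else 0) <= f r - f (maxn r n).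
Proof.
move=> a0 [f0 fp fs] Mr; elim: n => [|n IH].
  by rewrite big_ord_recl big_ord0 /= addr0 mulr0 maxn0 subrr.
rewrite big_ord_recr /= mulrDr; case: ltnP => rn; last first.
  by rewrite mulr0 addr0 (le_trans IH) // (maxn_idPl _) // ltnW.
move: IH; have -> : maxn r n = n by exact/maxn_idPr.
have := fs n; have : 1 <= (n.+1 - M)%:R :> R by rewrite ler1n; lia.
move=> /(ler_wpM2l a0) /(ler_wpM2l (fp n.+1)); lra.
Qed.

Lemma steep_value M a f m : 0 <= a -> steep M a f ->
  f (M + m)%N * (1 + a * m%:R) <= f 0%N.
Proof.
move=> a0 sf; have df := steep_decr a0 sf; case: sf => f0 fp fs.
case: m => [|m]; first by rewrite mulr0 addr0 mulr1 decr_le.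
have := fs (M + m)%N; rewrite addnS (_ : ((M + m).+1 - M = m.+1)%N); last lia.
by move=> /le_trans; apply; apply: decr_le.
Qed.

Lemma sum_initial n N (x : R) : 0 <= x ->
  \sum_(i < n) (if (i < N)%N then x else 0) <= N%:R * x.
Proof.
move=> x0; suff -> : \sum_(i < n) (if (i < N)%N then x else 0) = (minn n N)%:R * x.
  by rewrite ler_wpM2r // ler_nat geq_minr.
elim: n => [|n IH]; first by rewrite big_ord0 min0n mul0r.
rewrite big_ord_recr /= IH; have [nN|Nn] := leqP n.+1 N.
  by rewrite (minn_idPl (ltnW nN)) -natr1; ring.
by rewrite addr0 (minn_idPr _).
Qed.

(** [conv n f 0] is reused as the sum of the even function over [[-n, n]]. *)
Lemma conv0_le_double n f : (forall i, 0 <= f i) ->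
  conv n f 0 <= 2 * \sum_(i < n.+1) f i.
Proof.
move=> fp; rewrite conv_low // add0n subn0.
rewrite [X in _ <= 2 * X]big_ord_recl /= [X in X + _]big_ord_recl /=.
by have := fp 0%N; rewrite -[\sum_(i < n) f (bump 0 i)]/(\sum_(i < n) f i.+1); lra.
Qed.

Lemma conv0_ge n f N : (forall i, 0 <= f i) -> (N <= n)%N ->
  \sum_(i < N) f i <= conv n f 0.
Proof.
move=> fp Nn; rewrite conv_low // add0n subn0.
rewrite -(big_mkord xpredT f) -(big_mkord xpredT f)
  [X in _ <= X + _](@big_cat_nat _ _ _ N) ?leqW //=.
by rewrite -addrA lerDl addr_ge0 ?sumr_ge0.
Qed.

End SequenceBounds.

(** * The law of the height at the root *)

Section HeightLaw.
Context (R : realType) (V : choiceType) (e : rel V) (M : nat) (te : is_tree e).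
Context (lf : locally_finite e) (infV : infinite_set [set: V]) (v : V) (L : {fset V}).
Hypotheses (cL : connected_in e L) (vL : v \in L).

Local Notation T := (L `|` bdry e L)%fset.
Let rt : T := root e vL.
Let par : T -> T := tree_parent te vL.

Definition root_weight : nat -> R :=
  weight R M rt par (@tree_depth _ _ te v L) (@leaf _ e L) rt.

Lemma lipschitz0_tree (B : set int) :
  lipschitz0 (L := L) M `&` [set phi : height_fun e L | B (height phi v)] =
  tree_lipschitz M rt par (@leaf _ e L) B.
Proof.
have hv (phi : height_fun e L) : height phi v = phi rt.
  rewrite /height; case: insubP => [u _ uv /=|]; last by rewrite root_domain.
  by congr (phi _); apply: val_inj; rewrite uv.
have edge (x : T) : x != rt -> e (val x) (val (par x)).
  move=> xr; rewrite /par val_parent //.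
  by rewrite neq_root in xr; case: (parentP te xr).
apply/seteqP; split => phi /=.
  move=> [[lip zero] Bphi]; split; [|by move=> x bx; apply: zero|by rewrite -hv].
  by move=> x xr; apply: lip; exact: edge.
move=> [lip zero Bphi]; split; last by rewrite hv.
split; last by move=> x bx; apply: zero.
move=> x y xy; have [[xv yE]|[yv xE]] := edge_parent te v xy.
  have xr : x != rt by rewrite neq_root.
  have -> : y = par x by apply: val_inj; rewrite /par val_parent.
  exact: lip.
have yr : y != rt by rewrite neq_root.
have -> : x = par y by apply: val_inj; rewrite /par val_parent.
by rewrite distrC; apply: lip.
Qed.

Lemma lipschitz_depth phi (x : T) :
  tree_lipschitz M rt par (@leaf _ e L) setT phi ->
  `|phi x - phi rt| <= (M * depth te v (val x))%N%:Z.
Proof.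
move=> [lip _ _]; have [n] := ubnP (depth te v (val x)); elim: n x => // n IH x lt.
have [->|xr] := eqVneq x rt; first by rewrite subrr normr0.
have xv := xr; rewrite neq_root in xv; have [_ dx] := parentP te xv.
have px : val (par x) = parent te v (val x) by rewrite /par val_parent.
have := IH (par x); have := lip x xr; rewrite px dx mulnS.
by move: lt; rewrite dx; move: (phi x) (phi (par x)) (phi rt) => p q s; lia.
Qed.

(** An infinite tree leaves a nonempty boundary, where the function vanishes; the Lipschitz property
    carries the bound to the root. *)
Lemma root_height_bounded : exists n : nat,
  forall phi, tree_lipschitz M rt par (@leaf _ e L) setT phi -> `|phi rt| <= n%:Z.
Proof.
have [z zL] : exists z, z \notin L.
  apply: contrapT => all; apply: infV; apply: (sub_finite_set _ (finite_fset L)).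
  by move=> z _ /=; apply: contrapT => /negP zL; apply: all; exists z.
have [b bb _] := bdry_below te lf vL zL.
have bT : b \in T by rewrite inE bb orbT.
exists (M * depth te v b)%N => phi lip.
have := lipschitz_depth [` bT]%fset lip; case: lip => _ zero _.
by rewrite zero //= sub0r normrN.
Qed.

(** Root heights are bounded, so every large window sees the whole law. *)
Lemma height_lawE (P : pred nat) : exists n0, forall n, (n0 <= n)%N ->
  height_law R e M L v [set k : int | P `|k|%N] =
  conv n (fun j => if P j then root_weight j else 0) 0 / conv n root_weight 0.
Proof.
have [n0 bound] := root_height_bounded; exists n0 => n n0n.
have bound' phi : tree_lipschitz M rt par (@leaf _ e L) setT phi -> `|phi rt| <= n%:Z.
  by move=> /bound /le_trans; apply; rewrite lez_nat.
have card B := card_tree_lipschitz R (tree_depth_root te vL)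
  (fun x => tree_depth_parent te lf cL (x := x))
  (fun x => leaf_parent te lf cL (x := x)) bound' B.
have total : lipschitz0 (L := L) M = tree_lipschitz M rt par (@leaf _ e L) setT.
  by rewrite -lipschitz0_tree; apply/seteqP; split => phi //= [].
rewrite /height_law lipschitz0_tree total (card _).2 (card _).2.
have c0 := @tree_const_gt0 R M T rt.
rewrite -mulf_div divff ?gt_eqF // mul1r; congr (_ / _); apply: eq_bigr => i _.
  by rewrite add0r /root_weight; congr (if _ then _ else _); apply/asboolP/idP.
by rewrite add0r asboolT.
Qed.

(** On each side the tail is at most [root_weight (M + m) / a], and [steep_value] compares that
    weight with the one at 0. *)
Lemma law_tail a m : 0 < a -> steep M a root_weight ->
  height_law R e M L v [set k : int | (M + m < `|k|)%N] <= 2 / (a * (1 + a * m%:R)).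
Proof.
move=> a0 sw; have [n0 /(_ n0 (leqnn _)) ->] := height_lawE (fun j => M + m < j)%N.
have tail := steep_tail n0 (ltW a0) sw (leq_addr m M).
have value := steep_value m (ltW a0) sw.
have [w0 wp _] := sw.
set F := fun j : nat => if _ then _ else _.
have Fp j : 0 <= F j by rewrite /F; case: ifP.
have num := conv0_le_double n0 Fp.
have den : root_weight 0%N <= conv n0 root_weight 0.
  have [|n1] := posnP n0; last by have := conv0_ge wp n1; rewrite big_ord1.
  by move=> ->; rewrite conv_low // !big_ord_recl !big_ord0 !addr0.
have am : 0 < 1 + a * m%:R by rewrite ltr_pwDl // mulr_ge0 // ltW.
rewrite ler_pdivrMr; last exact: lt_le_trans den.
apply: (le_trans num); rewrite mulrAC ler_pdivlMr ?mulr_gt0 //.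
have : a * \sum_(i < n0.+1) F i <= root_weight (M + m)%N.
  by apply: le_trans tail _; rewrite gerBl.
move=> /(ler_wpM2r (ltW am)); lra.
Qed.

(** Heights below [N] in absolute value weigh at most [2 * N] times the weight at 0, while the
    heights [0, ..., K - 1] each weigh at least half of it. *)
Lemma law_center b N K (A : R) : 0 <= b -> gentle b root_weight ->
  A < N%:R -> (0 < K)%N -> b * (K ^ 2)%:R <= 1 / 2 ->
  height_law R e M L v [set k : int | `|k%:~R : R| <= A] <= 4 * N%:R / K%:R.
Proof.
move=> b0 gw AN K0 bK.
have [w0 [r wr]] := gw.
have wp := gentle_ge0 w0 wr; have wd := gentle_decr w0 wr.
have -> : [set k : int | `|k%:~R : R| <= A] = [set k : int | (`|k|%N)%:R <= A].
  by apply/seteqP; split => k /=; rewrite -intr_norm natr_absz.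
have [n0 /(_ (maxn n0 K) (leq_maxl _ _)) ->] := height_lawE (fun j => j%:R <= A).
set F := fun j : nat => if _ then _ else _.
have Fp j : 0 <= F j by rewrite /F; case: ifP.
have num := conv0_le_double (maxn n0 K) Fp.
have F0 : \sum_(i < (maxn n0 K).+1) F i <= N%:R * root_weight 0%N.
  apply: le_trans (sum_initial (maxn n0 K).+1 N (ltW w0)).
  apply: ler_sum => i _; rewrite /F; case: ifP => iA.
    by rewrite -(ltr_nat R) (le_lt_trans iA AN) decr_le.
  by case: ifP => // _; rewrite ltW.
have den : K%:R * (root_weight 0%N / 2) <= conv (maxn n0 K) root_weight 0.
  apply: le_trans (conv0_ge wp (leq_maxr n0 K)).
  rewrite mulr_natl -[X in _ *+ X]card_ord -sumr_const; apply: ler_sum => i _.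
  apply: le_trans (gentle_lower w0 wr i b0); rewrite ler_pM2l //.
  have : b * (i ^ 2)%:R <= b * (K ^ 2)%:R.
    by rewrite ler_wpM2l // ler_nat leq_exp2r // ltnW.
  lra.
have K0' : 0 < K%:R :> R by rewrite ltr0n.
rewrite ler_pdivrMr; last by apply: lt_le_trans den; rewrite mulr_gt0 ?divr_gt0.
apply: (le_trans num).
have : 4 * N%:R / K%:R * (K%:R * (root_weight 0%N / 2)) <=
  4 * N%:R / K%:R * conv (maxn n0 K) root_weight 0.
  by rewrite ler_wpM2l // divr_ge0 ?mulr_ge0 // ltW.
apply: le_trans.
have -> : 4 * N%:R / K%:R * (K%:R * (root_weight 0%N / 2)) = 2 * (N%:R * root_weight 0%N).
  by field; rewrite gt_eqF.
by rewrite ler_pM2l.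
Qed.

End HeightLaw.

(** * Return and hitting probabilities of the walk *)

Section RandomWalk.
Context (R : realType) (V : choiceType) (e : rel V) (te : is_tree e).
Context (lf : locally_finite e) (v : V).

Definition neighbours x : {fset V} := fset_set [set y | e x y].

Lemma in_neighbours x y : (y \in neighbours x) = e x y.
Proof.
rewrite /neighbours in_fset_set; last exact: lf.
by apply/idP/idP; rewrite inE.
Qed.

Lemma deg_sum x : (deg e x)%:R = \sum_(y <- neighbours x) 1 :> R.
Proof. by rewrite big_const_seq count_predT iter_addr_0. Qed.

Local Notation p x := ((deg e x)%:R^-1 : R).

(* The probability that the walk from x visits v during steps 1, ..., m + 1. *)
Fixpoint hit m x : R :=
  \sum_(y <- neighbours x)
     p x * (if y == v then 1 else if m is m'.+1 then hit m' y else 0).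

Fixpoint walks m x : seq (seq V) :=
  [::] :: if m is m'.+1 then
    flatten [seq [seq y :: t | t <- walks m' y] | y <- neighbours x & y != v]
  else [::].

Lemma walk_prob_ge0 x s : 0 <= walk_prob R e x s.
Proof.
elim: s x => [|y s IH] x //=; rewrite mulr_ge0 //.
by case: ifP => // _; rewrite invr_ge0.
Qed.

Lemma walks_sum m x :
  \sum_(t <- walks m x) walk_prob R e x (rcons t v) = hit m x.
Proof.
have step y : \sum_(z <- neighbours y) p y * (z == v)%:R =
    walk_prob R e y [:: v].
  rewrite /= mulr1; case: ifPn => yv; last first.
    rewrite big_seq big1 // => z; rewrite in_neighbours => yz.
    by case: eqP => [zv|_]; [rewrite -zv yz in yv|rewrite mulr0].
  rewrite (big_fsetD1 v) /=; last by rewrite in_neighbours.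
  rewrite eqxx mulr1 big_seq big1 ?addr0 // => z; rewrite !inE => /andP[zv _].
  by rewrite (negPf zv) mulr0.
elim: m x => [|m IH] x /=; rewrite big_cons.
  rewrite big_nil addr0 -step; apply: eq_bigr => y _.
  by case: ifP.
rewrite -step big_flatten big_map big_filter [X in _ + X]big_mkcond -big_split /=.
rewrite big_seq [RHS]big_seq; apply: eq_bigr => y; rewrite in_neighbours => xy.
case: eqVneq => yv /=; first by rewrite addr0.
rewrite mulr0 add0r big_map -(IH y) mulr_sumr.
by apply: eq_bigr => t _; rewrite /= xy.
Qed.

Lemma walks_avoid m x t : t \in walks m x -> v \notin t.
Proof.
elim: m x t => [|m IH] x t; rewrite /= inE.
  by move=> /eqP ->.
case/predU1P => [-> //|/flattenP[s /mapP[y]]].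
rewrite mem_filter => /andP[yv _] -> /mapP[t' /IH vt ->].
by rewrite inE negb_or eq_sym yv.
Qed.

Lemma walks_uniq m x : uniq (walks m x).
Proof.
elim: m x => [|m IH] x //=; apply/andP; split.
  by apply/negP => /flattenP[s /mapP[y _ ->] /mapP[]].
have : uniq [seq y <- neighbours x | y != v] by rewrite filter_uniq ?fset_uniq.
elim: [seq y <- neighbours x | y != v] => //= y s IHs /andP[ys us].
rewrite cat_uniq IHs // andbT map_inj_uniq ?IH /=; last by move=> ? ? [].
apply/hasPn => t /flattenP[s' /mapP[z zs ->] /mapP[t1 _ ->]].
by apply/mapP => -[t2 _ [zy _]]; rewrite -zy zs in ys.
Qed.

Lemma mem_walks m x t : v \notin t -> (size t <= m)%N ->
  walk_prob R e x (rcons t v) != 0 -> t \in walks m x.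
Proof.
elim: t m x => [|y t IH] [|m] x //=; rewrite ?inE //= negb_or => /andP[vy vt] sz.
rewrite mulf_eq0 negb_or => /andP[xy nz]; apply/flattenP.
exists [seq y :: t' | t' <- walks m y]; last by apply/mapP; exists t => //; apply: IH.
apply/mapP; exists y => //; rewrite mem_filter eq_sym vy in_neighbours.
by move: xy; case: ifP; rewrite ?eqxx.
Qed.

Lemma hit_le_return m : ((hit m v)%:E <= return_prob R e v)%E.
Proof.
rewrite -walks_sum -sumEFin fsbig_seq ?walks_uniq //.
apply: ereal_sup_ubound; exists [set` walks m v] => //; split.
  exact: finite_seq.
by move=> t /= /walks_avoid.
Qed.

(** A finite partial sum above [c] uses sequences of bounded length, and those of nonzero
    probability all occur in [walks]. *)
Lemma return_le_hit (c : R) : (c%:E < return_prob R e v)%E ->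
  exists m, c < hit m v.
Proof.
move=> /ereal_sup_gt[_ [X [finX Xv] <-]].
rewrite fsbig_finite //= sumEFin lte_fin => cX.
exists (\max_(t <- fset_set X) size t); apply: (lt_le_trans cX).
rewrite -walks_sum; set m := \max_(t <- _) _.
rewrite [X in X <= _](bigID (fun t => walk_prob R e v (rcons t v) == 0)) /=.
rewrite big1 ?add0r; last by move=> t /eqP.
rewrite -big_filter; set s := [seq _ <- _ | _].
have us : uniq s by rewrite filter_uniq ?fset_uniq.
have sub : {subset s <= walks m v}.
  move=> t; rewrite mem_filter => /andP[nz tX]; apply: mem_walks nz.
    by move: tX; rewrite in_fset_set // inE => /Xv.
  by rewrite /m (big_fsetD1 t) //= leq_maxl.
rewrite [leRHS](bigID (mem s)) /= -[X in _ <= X + _]big_filter.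
have ps : perm_eq [seq t <- walks m v | t \in s] s.
  apply: uniq_perm => //; first by rewrite filter_uniq ?walks_uniq.
  by move=> t; rewrite mem_filter andb_idr //; exact: sub.
by rewrite (perm_big _ ps) lerDl sumr_ge0 // => t _; exact: walk_prob_ge0.
Qed.

Lemma avg_le (x : V) (S h : R) : 0 <= h -> S <= (deg e x)%:R * h -> p x * S <= h.
Proof.
move=> h0 Sh; have [->|d0] := eqVneq (deg e x) 0%N; first by rewrite invr0 mul0r.
by rewrite mulrC ler_pdivrMr ?ltr0n ?lt0n // mulrC.
Qed.

(** Maximum principle by induction on the number of steps. Each step changes the depth by at most
    one, so superharmonicity is only called on up to depth [m]. *)
Lemma hit_superharmonic (h : V -> R) m :
  (forall x, 0 <= h x) -> h v = 1 ->
  (forall y, y != v -> (depth te v y <= m)%N ->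
     \sum_(z <- neighbours y) h z <= (deg e y)%:R * h y) ->
  forall k x, (depth te v x + k <= m)%N ->
  hit k x <= p x * \sum_(z <- neighbours x) h z.
Proof.
move=> h0 hv sup; elim=> [|k IH] x xm /=; rewrite mulr_sumr big_seq [leRHS]big_seq;
    apply: ler_sum => y; rewrite in_neighbours => xy;
    rewrite ler_wpM2l ?invr_ge0 //; case: eqVneq => [->|yv]; rewrite ?hv //.
have dy : (depth te v y <= (depth te v x).+1)%N.
  have [[xv ->]|[_ ->]] := edge_parent te v xy.
    by have [_ ->] := parentP te xv; rewrite leqW // leqW.
  by have [_ <-] := parentP te yv.
apply: (le_trans (IH y _)); first by move: xm dy; lia.
by apply: avg_le => //; apply: sup => //; move: xm dy; lia.
Qed.

Lemma hit_ge0 m x : 0 <= hit m x.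
Proof.
elim: m x => [|m IH] x; apply: sumr_ge0 => y _; rewrite mulr_ge0 ?invr_ge0 //;
  by case: ifP.
Qed.

Lemma hit_le1 m x : hit m x <= 1.
Proof.
have le1 (a : V -> R) y : (forall z, a z <= 1) -> \sum_(z <- neighbours y) p y * a z <= 1.
  move=> a1; rewrite -mulr_sumr; apply: avg_le; rewrite // mulr1 deg_sum.
  exact: ler_sum.
by elim: m x => [|m IH] x; apply: le1 => z; case: ifP.
Qed.

Lemma hit_nondecreasing x : {homo hit^~ x : m n / (m <= n)%N >-> m <= n}.
Proof.
suff step m y : hit m y <= hit m.+1 y.
  by apply: homo_leq => // a b c; apply: le_trans.
elim: m y => [|m IH] y /=; apply: ler_sum => z _; rewrite ler_wpM2l ?invr_ge0 //.
  by case: ifP => // _; exact: (hit_ge0 0).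
by case: ifP => // _; exact: (IH z).
Qed.

(** [hit] ignores time 0, hence the separate value at [v]. *)
Definition hitting x : R := if x == v then 1 else limn (hit^~ x).

Lemma hit_cvg x : hit^~ x @ \oo --> limn (hit^~ x).
Proof.
apply: nondecreasing_is_cvgn; first exact: hit_nondecreasing.
by exists 1 => _ [m _ <-]; exact: hit_le1.
Qed.

Lemma hit_le_hitting m x : x != v -> hit m x <= hitting x.
Proof.
move=> xv; rewrite /hitting (negPf xv).
by apply: nondecreasing_cvgn_le; [exact: hit_nondecreasing|exact: hit_cvg].
Qed.

Lemma hitting_root : hitting v = 1. Proof. by rewrite /hitting eqxx. Qed.

Lemma hitting_ge0 x : 0 <= hitting x.
Proof.
have [->|xv] := eqVneq x v; first by rewrite hitting_root.
exact: le_trans (hit_ge0 0 x) (hit_le_hitting 0 xv).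
Qed.

Lemma cvg_seq_sum (s : seq V) (a : nat -> V -> R) (l : V -> R) :
  (forall y, a^~ y @ \oo --> l y) ->
  (fun m => \sum_(y <- s) a m y) @ \oo --> \sum_(y <- s) l y.
Proof.
move=> al; elim: s => [|y s IH].
  by under eq_fun do rewrite big_nil; rewrite big_nil; exact: cvg_cst.
by under eq_fun do rewrite big_cons; rewrite big_cons; exact: cvgD.
Qed.

Lemma hit_limit x :
  (fun m => hit m.+1 x) @ \oo --> p x * \sum_(y <- neighbours x) hitting y.
Proof.
rewrite mulr_sumr; apply: cvg_seq_sum => y; apply: cvgM; first exact: cvg_cst.
by rewrite /hitting; case: ifP => _; [exact: cvg_cst|exact: hit_cvg].
Qed.

Lemma hitting_avg_le x (c : R) : (forall m, hit m x <= c) ->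
  p x * \sum_(y <- neighbours x) hitting y <= c.
Proof.
move=> hc; rewrite -(cvg_lim _ (hit_limit (x := x))) //.
apply: limr_le; first by apply/cvg_ex; eexists; exact: hit_limit.
by near=> m; exact: hc.
Unshelve. all: end_near.
Qed.

Lemma hitting_superharmonic x : x != v -> (0 < deg e x)%N ->
  \sum_(y <- neighbours x) hitting y <= (deg e x)%:R * hitting x.
Proof.
move=> xv dx; have := hitting_avg_le (fun m => hit_le_hitting m xv).
by rewrite mulrC ler_pdivrMr ?ltr0n // mulrC.
Qed.

Lemma hitting_gt0 x : 0 < hitting x.
Proof.
have [n] := ubnP (depth te v x); elim: n x => // n IH x lt.
have [->|xv] := eqVneq x v; first by rewrite hitting_root.
have [xp dp] := parentP te xv.
have dx : (0 < deg e x)%N.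
  by rewrite cardfs_gt0; apply/fset0Pn; exists (parent te v x); rewrite in_neighbours.
have := hitting_superharmonic xv dx.
rewrite (big_fsetD1 (parent te v x)) /=; last by rewrite in_neighbours.
have : 0 < hitting (parent te v x) by apply: IH; lia.
have : 0 <= \sum_(y <- (neighbours x `\ parent te v x)%fset) hitting y.
  by apply: sumr_ge0 => y _; exact: hitting_ge0.
move=> h1 h2 h3; rewrite -(pmulr_rgt0 _ (_ : 0 < (deg e x)%:R)) ?ltr0n //.
lra.
Qed.

(** The mean of [hitting] over the neighbours of [v] is at most the return probability. *)
Lemma hitting_transient : (0 < deg e v)%N -> (return_prob R e v < 1)%E ->
  \sum_(y <- neighbours v) hitting y < (deg e v)%:R.
Proof.
move=> dv ret.
have rE : (return_prob R e v)%E = (fine (return_prob R e v))%:E.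
  rewrite fineK // fin_numE; apply/andP; split; apply/eqP => E.
    by have := hit_le_return 0; rewrite E.
  by rewrite E in ret.
have := @hitting_avg_le v (fine (return_prob R e v)) _.
rewrite mulrC ler_pdivrMr ?ltr0n // => h.
apply: (@le_lt_trans _ _ (fine (return_prob R e v) * (deg e v)%:R)).
  by apply: h => m; rewrite -lee_fin -rE; exact: hit_le_return.
by rewrite gtr_pMl ?ltr0n // -lte_fin -rE.
Qed.

End RandomWalk.

(** * Localization of transient trees, delocalization of recurrent ones *)

Section Dichotomy.
Context (R : realType) (V : choiceType) (e : rel V) (M : nat) (te : is_tree e).
Context (lf : locally_finite e) (infV : infinite_set [set: V]).

Lemma deg_gt0 x : (0 < deg e x)%N.
Proof.
have [z zx] : exists z, z != x.
  apply: contrapT => all; apply: infV; apply: (sub_finite_set _ (finite_set1 x)).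
  by move=> z _ /=; apply: contrapT => /eqP zx; apply: all; exists z.
have [[|y s] /= xs sz] := tree_connected te x z; first by rewrite sz eqxx in zx.
rewrite cardfs_gt0; apply/fset0Pn; exists y; rewrite -/(neighbours e x) in_neighbours //.
by case/andP: xs.
Qed.

Section Domain.
Context (v : V) (L : {fset V}).
Hypotheses (cL : connected_in e L) (vL : v \in L).

Local Notation T := (L `|` bdry e L)%fset.
Local Notation rt := (root e vL).
Local Notation par := (tree_parent te vL).
Local Notation isleaf := (@leaf _ e L).
Local Notation chld := (child rt par).
Local Notation G := (weight R M rt par (@tree_depth _ _ te v L) isleaf).

Let d_root := tree_depth_root te vL.
Let d_par (x : T) (xr : x != rt) := tree_depth_parent te lf cL xr.

Lemma weight_leaf x : isleaf x -> G x = (fun k => (k == 0)%:R).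
Proof. by move=> lx; apply/funext => k; rewrite (weightE _ _ _ d_par) lx. Qed.

Lemma weight_inner x : ~~ isleaf x -> G x = (fun k => \prod_(c | chld x c) conv M (G c) k).
Proof. by move=> /negPf lx; apply/funext => k; rewrite (weightE _ _ _ d_par) lx. Qed.

Lemma root_innerN : ~~ isleaf rt.
Proof. exact: inner_leafN. Qed.

Lemma parent_child x c : chld x c -> parent te v (val c) = val x.
Proof. by move=> /andP[cr /eqP <-]; rewrite val_parent. Qed.

Lemma deg_children (x : T) : val x \in L ->
  (deg e (val x))%:R = (x != rt)%:R + \sum_(c | chld x c) 1 :> R.
Proof.
move=> xL; rewrite deg_sum (neighbours_sum te lf cL vL (fun=> 1) xL).
by case: eqVneq.
Qed.

(* The positive part spares a proof that hitting decreases away from v. *)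
Definition escape (c : T) : R :=
  Num.max 0 (1 - hitting R e v (val c) / hitting R e v (parent te v (val c))).

Lemma escape_ge0 c : 0 <= escape c. Proof. by rewrite /escape le_max lexx. Qed.

Lemma escape_lt1 c : escape c < 1.
Proof.
by rewrite /escape gt_max ltr01 ltrBlDl ltrDr divr_gt0 ?hitting_gt0.
Qed.

(** With [P] and [h] the hitting probabilities at the parent and at [c], superharmonicity at [c]
    gives [P - h <= S * h], that is [1 - h / P <= S / (1 + S)]. *)
Lemma escape_children c : c != rt -> ~~ isleaf c ->
  escape c <= (\sum_(c' | chld c c') escape c') / (1 + \sum_(c' | chld c c') escape c').
Proof.
move=> cr cl; set S := \sum_(c' | _) _.
have S0 : 0 <= S by apply: sumr_ge0 => ? _; exact: escape_ge0.
have cv : val c != v by rewrite -(neq_root vL).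
have cL' := leafN cl.
rewrite /escape ge_max divr_ge0 ?addr_ge0 //=.
set h := hitting R e v (val c); set P := hitting R e v _.
have h0 : 0 < h by exact: hitting_gt0. have P0 : 0 < P by exact: hitting_gt0.
have sup : P + \sum_(c' | chld c c') hitting R e v (val c') <=
    (1 + \sum_(c' | chld c c') 1) * h.
  have := hitting_superharmonic R cv (deg_gt0 (val c)).
  rewrite (deg_children cL') cr (neighbours_sum te lf cL vL _ cL') (negPf cr).
  by [].
have low : \sum_(c' | chld c c') (h - hitting R e v (val c')) <= S * h.
  rewrite mulr_suml; apply: ler_sum => c' cc'.
  have : 1 - hitting R e v (val c') / h <= escape c'.
    by rewrite /escape (parent_child cc') le_max lexx orbT.
  by move=> /(ler_wpM2r (ltW h0)); rewrite mulrBl mul1r divfK ?gt_eqF.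
rewrite sumrB in low.
have cst : \sum_(c' | chld c c') h = (\sum_(c' | chld c c') 1) * h.
  by rewrite mulr_suml; apply: eq_bigr => ? _; rewrite mul1r.
rewrite ler_pdivlMr ?ltr_pwDl // mulrBl mul1r.
have : P * (1 - h / P * (1 + S)) <= 0.
  have -> : P * (1 - h / P * (1 + S)) = P - h * (1 + S) by field; rewrite gt_eqF.
  move: sup low; rewrite cst; lra.
by rewrite pmulr_rle0 //; lra.
Qed.

Lemma escape_steep c : c != rt -> steep M (escape c / loss R M) (conv M (G c)).
Proof.
have l0 := loss_gt0 R M.
elim/(tree_ind d_par): c => c IH cr.
have [cl|cl] := boolP (isleaf c).
  rewrite (weight_leaf cl).
  have e0 := escape_ge0 c; have e1 := escape_lt1 c.
  (* Solves [a / (1 + loss * a) = escape c / loss], possible as [escape c < 1]; the delta is steep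
     for every parameter. *)
  pose a := escape c / loss R M / (1 - escape c).
  have a0 : 0 <= a by rewrite !divr_ge0 ?(ltW l0) // subr_ge0 ltW.
  apply: steep_weaken (steep_conv a0 (steep_delta M a)).
  rewrite le_eqVlt; apply/orP; left; apply/eqP; rewrite /a.
  by field; rewrite !gt_eqF ?subr_gt0 //=; lra.
set S := \sum_(c' | chld c c') escape c'.
have S0 : 0 <= S by apply: sumr_ge0 => ? _; exact: escape_ge0.
have sc : steep M (S / loss R M) (G c).
  rewrite (weight_inner cl) /S mulr_suml; apply: steep_prod => c' cc'.
    by rewrite divr_ge0 ?escape_ge0 // ltW.
  by apply: IH => //; case/andP: cc'.
have a0 : 0 <= S / loss R M by rewrite divr_ge0 // ltW.
apply: steep_weaken (steep_conv a0 sc).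
have -> : S / loss R M / (1 + loss R M * (S / loss R M)) = S / (1 + S) / loss R M.
  by field; rewrite !gt_eqF //; lra.
by rewrite ler_pM2r ?invr_gt0 // escape_children.
Qed.

(** As [hitting] is 1 at [v], each child [c] of the root has [escape c >= 1 - hitting c]. The
    resulting bound does not involve [L]. *)
Lemma root_steep : (return_prob R e v < 1)%E ->
  steep M (((deg e v)%:R - \sum_(y <- neighbours e v) hitting R e v y) / loss R M)
    (root_weight R M te vL).
Proof.
move=> ret; have l0 := loss_gt0 R M.
have sr : steep M ((\sum_(c | chld rt c) escape c) / loss R M) (root_weight R M te vL).
  rewrite /root_weight (weight_inner root_innerN) mulr_suml; apply: steep_prod => c cc.
    by rewrite divr_ge0 ?escape_ge0 // ltW.
  by apply: escape_steep; case/andP: cc.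
apply: steep_weaken sr; rewrite ler_pM2r ?invr_gt0 //.
rewrite (neighbours_sum te lf cL vL _ (x := rt)) //= eqxx add0r.
rewrite (deg_children (x := rt)) //= eqxx add0r -sumrB; apply: ler_sum => c cc.
by rewrite /escape (parent_child cc) hitting_root divr1 le_max lexx orbT.
Qed.

Lemma root_gentle : (0 < M)%N -> exists2 b : R, 0 <= b /\ gentle b (root_weight R M te vL) &
  forall m, (forall u, u \in bdry e L -> dist_ge e v u m.+1) ->
  hit R e v m v <= 1 - gain R M * b / (deg e v)%:R.
Proof.
move=> M0; set g := gain R M.
have g0 : 0 < g by rewrite invr_gt0 mulr_gt0 ?exprn_gt0.
(* Parallel and series laws from the value 2 at the boundary, capped at 2 as [gentle_conv] asks. *)
pose step (x : T) (b : T -> R) : R := if isleaf x then 2 else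
  Num.min (\sum_(c | chld x c) b c / (1 + g * b c)) 2.
have [b bE] : exists b : T -> R, forall x, b x = step x b.
  apply: (tree_rec d_par) 0 => x f h fh; rewrite /step; case: ifP => // _.
  by congr Num.min; apply: eq_bigr => c /fh ->.
have b02 x : 0 <= b x <= 2.
  elim/(tree_ind d_par): x => x IH; rewrite bE /step; case: ifP => _; first by lra.
  rewrite le_min ge_min lexx orbT !andbT; apply/andP; split; last by lra.
  apply: sumr_ge0 => c /IH/andP[bc _].
  by rewrite divr_ge0 // addr_ge0 // mulr_ge0 // ltW.
have b0 x : 0 <= b x by case/andP: (b02 x).
have gb0 x : 0 <= g * b x by rewrite mulr_ge0 // ltW.
have gent x : gentle (b x) (G x).
  elim/(tree_ind d_par): x => x IH; rewrite bE /step; case: ifPn => lx.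
    by rewrite (weight_leaf lx); exact: gentle_delta.
  rewrite (weight_inner lx); apply/gentle_cap/gentle_prod => c /IH gc.
  apply: gentle_weaken (gentle_conv M0 (b02 c) gc).
  (* [(b - g b^2) (1 + g b) = b - g^2 b^3 <= b]. *)
  rewrite ler_pdivlMr ?ltr_pwDl // -/g.
  have : 0 <= g * b c * (g * b c * b c) by rewrite !mulr_ge0 // ltW.
  by rewrite expr2; lra.
exists (b rt); first by split; [exact: b0|exact: gent].
move=> m far.
(* The superharmonic function: the product of [1 / (1 + g * b)] along the path from the root,
   extended by 0 off the domain. *)
pose fix hrec n (x : T) {struct n} : R :=
  if n is n'.+1 then hrec n' (par x) / (1 + g * b x) else 1.
pose hT (x : T) := hrec (tree_depth te v x) x.
have hT_root : hT rt = 1 by rewrite /hT d_root.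
have hT_child x c : chld x c -> hT c = hT x / (1 + g * b c).
  by move=> cx; rewrite /hT (child_depth d_par cx) /=; case/andP: cx => _ /eqP ->.
have hrec_ge0 n x : 0 <= hrec n x.
  by elim: n x => //= n IH x; rewrite divr_ge0 // addr_ge0.
have hT_ge0 x : 0 <= hT x by exact: hrec_ge0.
pose h (y : V) : R := oapp hT 0 (insub y).
have hval (x : T) : h (val x) = hT x by rewrite /h valK.
have children_sum (x : T) : val x \in L ->
    \sum_(c | chld x c) h (val c) =
    hT x * (\sum_(c | chld x c) 1 - g * \sum_(c | chld x c) b c / (1 + g * b c)).
  move=> xL; rewrite mulr_sumr -sumrB mulr_sumr; apply: eq_bigr => c cx.
  by rewrite hval (hT_child x) //; field; rewrite gt_eqF // ltr_pwDl.
have b_inner (x : T) : val x \in L -> b x <= \sum_(c | chld x c) b c / (1 + g * b c).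
  move=> xL; rewrite bE /step ifN; first by rewrite ge_min lexx.
  exact: inner_leafN.
have near (y : V) : (depth te v y <= m)%N -> y \in L.
  move=> ym; apply/negPn/negP => yL.
  have [u ub ud] := bdry_below te lf vL yL.
  have [s [vs su ss]] := depth_path te v u.
  by have := far u ub s vs su; rewrite ss; move: ud ym; lia.
have sup (y : V) : y != v -> (depth te v y <= m)%N ->
    \sum_(z <- neighbours e y) h z <= (deg e y)%:R * h y.
  move=> yv /near yL; have yT : y \in T by rewrite inE yL.
  pose x : T := [` yT]%fset; have xL : val x \in L by [].
  have xr : x != rt by rewrite neq_root.
  rewrite (neighbours_sum te lf cL vL h xL) (negPf xr) (children_sum x xL).
  rewrite (deg_children xL) xr -[true%:R]/(1 : R).
  have -> : h y = hT x by rewrite -hval.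
  have -> : h (parent te v (val x)) = hT x * (1 + g * b x).
    rewrite -val_parent // hval (hT_child (par x) x) ?divfK //.
      by rewrite gt_eqF // ltr_pwDl.
    by apply/andP.
  (* Relative to [hT x], the excess [g * b x] of the parent is at most the total deficit of the
     children. *)
  have : g * b x <= g * \sum_(c | chld x c) b c / (1 + g * b c).
    by rewrite ler_pM2l // b_inner.
  by move=> /(ler_wpM2l (hT_ge0 x)); lra.
have h0 y : 0 <= h y by rewrite /h; case: insubP => //= x _ _; exact: hT_ge0.
have hv : h v = 1 by rewrite -hT_root -hval.
have := @hit_superharmonic R V e te lf v h m h0 hv sup m v.
rewrite depth_root add0n leqnn => /(_ isT) /le_trans; apply.
rewrite (neighbours_sum te lf cL vL h (x := rt)) //= eqxx add0r children_sum //.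
rewrite hT_root mul1r.
have dE := deg_children (x := rt) vL; rewrite eqxx add0r /= in dE; rewrite -dE.
have d0 : 0 < (deg e v)%:R :> R by rewrite ltr0n deg_gt0.
rewrite mulrBr mulVf ?gt_eqF // lerD2l lerN2 [leRHS]mulrC ler_pM2r ?invr_gt0 //.
by rewrite ler_pM2l // b_inner.
Qed.

End Domain.

Lemma transient_localized : transient R e -> localized R e M.
Proof.
move=> tr v eps eps0; have ret := tr v.
pose a := ((deg e v)%:R - \sum_(y <- neighbours e v) hitting R e v y) / loss R M.
have a0 : 0 < a.
  by rewrite divr_gt0 ?loss_gt0 // subr_gt0 hitting_transient // deg_gt0.
(* Makes the bound [2 / (a * (1 + a * m))] of [law_tail] smaller than [eps]. *)
pose m := (Num.truncn (2 / (a * a * eps))).+1.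
have mE : 2 / (a * a * eps) < m%:R by exact: truncnS_gt.
exists [set k : int | (`|k| <= M + m)%N].
  apply: (@sub_finite_set _ _ ((fun i : nat => i%:Z - (M + m)%N%:Z) @` `I_(M + m).*2.+1)).
    move=> k /= km; exists (absz (k + (M + m)%N%:Z)); last by lia.
    by rewrite /mkset; lia.
  exact: finite_image.
move=> _ [L [cL vL] <-].
have -> : ~` [set k : int | (`|k| <= M + m)%N] = [set k : int | (M + m < `|k|)%N].
  by apply/seteqP; split => k; rewrite /setC /= ltnNge => /negP.
have := law_tail lf infV cL (vL := vL) m a0 (root_steep cL vL ret).
move=> /le_lt_trans; apply.
rewrite ltr_pdivrMr; last by rewrite mulr_gt0 // ltr_pwDl // mulr_ge0 // ltW.
have aae := mulr_gt0 (mulr_gt0 a0 a0) eps0; have ea := mulr_gt0 eps0 a0.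
by move: mE; rewrite ltr_pdivrMr //; lra.
Qed.

Lemma recurrent_root_delocalized (v : V) (A eps : R) : (0 < M)%N ->
  ~ (return_prob R e v < 1)%E -> 0 < A -> 0 < eps ->
  exists n, forall L : {fset V}, connected_in e L -> v \in L ->
    (forall u, u \in bdry e L -> dist_ge e v u n) ->
    height_law R e M L v [set k : int | `|k%:~R : R| <= A] < eps.
Proof.
move=> M0 /negP; rewrite -leNgt => ret A0 eps0.
pose N := (Num.truncn A).+1.
have AN : A < N%:R by exact: truncnS_gt.
pose K := (Num.truncn (4 * N%:R / eps)).+1.
have KE : 4 * N%:R / eps < K%:R by exact: truncnS_gt.
have K0 : 0 < K%:R :> R by rewrite ltr0n.
have g0 : 0 < gain R M by rewrite invr_gt0 mulr_gt0 ?exprn_gt0.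
have d0 : 0 < (deg e v)%:R :> R by rewrite ltr0n deg_gt0.
(* A root parameter below [eta] meets the condition [b * K^2 <= 1/2] of [law_center]. *)
pose eta : R := 1 / 2 / (K ^ 2)%:R.
have K20 : 0 < (K ^ 2)%:R :> R by rewrite ltr0n expn_gt0.
have eta0 : 0 < eta by rewrite !divr_gt0.
(* By recurrence, return within finitely many steps becomes so likely that [root_gentle] forces
   [b < eta]. *)
have [m hm] : exists m, 1 - gain R M * eta / (deg e v)%:R < hit R e v m v.
  apply: return_le_hit => //; apply: lt_le_trans ret.
  by rewrite lte_fin gtrBl divr_gt0 //; exact: mulr_gt0.
exists m.+1 => L cL vL far.
have [b [b0 gb] hb] := root_gentle cL vL M0.
have be : b < eta.
  have := lt_le_trans hm (hb m far).
  by rewrite ltrD2l ltrN2 ltr_pM2r ?invr_gt0 // ltr_pM2l.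
have bK : b * (K ^ 2)%:R <= 1 / 2.
  by rewrite -ler_pdivlMr // ltW.
apply: le_lt_trans (law_center lf infV cL b0 gb AN _ bK) _ => //.
by rewrite ltr_pdivrMr // [eps * _]mulrC -ltr_pdivrMr.
Qed.

(* |phi w - phi v| <= M d(v, w). *)
Lemma law_transfer (v w : V) (L : {fset V}) (A : R) :
  connected_in e L -> v \in L -> w \in L ->
  height_law R e M L w [set k : int | `|k%:~R : R| <= A] <=
  height_law R e M L v [set k : int | `|k%:~R : R| <= A + (M * depth te v w)%:R].
Proof.
move=> cL vL wL; rewrite /height_law ler_wpM2r ?invr_ge0 // ler_nat.
have [n bound] := root_height_bounded M te lf infV cL vL.
have finB B : finite_set (tree_lipschitz M (root e vL) (tree_parent te vL) (@leaf _ e L) B).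
  exact: (card_tree_lipschitz R (tree_depth_root te vL)
    (fun x => tree_depth_parent te lf cL (x := x))
    (fun x => leaf_parent te lf cL (x := x)) bound B).1.
have total : lipschitz0 (L := L) M =
    tree_lipschitz M (root e vL) (tree_parent te vL) (@leaf _ e L) setT.
  by rewrite -(lipschitz0_tree M te lf cL vL); apply/seteqP; split => phi //= [].
have finT (X : set (height_fun e L)) : finite_set (lipschitz0 (L := L) M `&` X).
  by apply: sub_finite_set (finB setT); rewrite total => phi [].
apply/fsubset_leq_card/fsubsetP => phi; rewrite !in_fset_set // !inE /= => -[lip Aphi].
split => //.
have lip' : tree_lipschitz M (root e vL) (tree_parent te vL) (@leaf _ e L) setT phi.
  by rewrite -total.
have wT : w \in (L `|` bdry e L)%fset by rewrite inE wL.
have hE (x : (L `|` bdry e L)%fset) : height phi (val x) = phi x.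
  by rewrite /height valK.
have := lipschitz_depth lf cL [` wT]%fset lip'.
rewrite -!hE /= -(ler_int R) intr_norm rmorphB /= => close.
apply: le_trans (_ : _ <= `|(height phi w)%:~R| + `|(height phi w)%:~R - (height phi v)%:~R|) _.
  rewrite distrC -{1}[(height phi v)%:~R](subrK (height phi w)%:~R) addrC.
  exact: ler_normD.
by rewrite lerD // -pmulrn.
Qed.

Lemma recurrent_delocalized : (0 < M)%N -> ~ transient R e -> delocalized R e M.
Proof.
(* Non-transience provides one recurrent vertex [v]; the law at [w] is compared with the law at
   [v]. *)
move=> M0 /existsNP[v ret] w A A0 eps eps0.
pose D := depth te v w.
have [s [vs sw sD]] := depth_path te v w.
have A'0 : 0 < A + (M * D)%:R by rewrite ltr_wpDr.
have [n hn] := recurrent_root_delocalized M0 ret A'0 eps0.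
have [q [wq qv qD]] := depth_path te w v.
(* The radius exceeds the distance from [w] to [v], so [v] lies in [L], and it keeps the boundary at
   distance at least [n] from [v]. *)
exists (n + size q).+1 => L cL wL far.
have vL : v \in L.
  apply/negPn/negP => vL; have [b bb bd] := bdry_below te lf wL vL.
  have [r [wr rb rD]] := depth_path te w b.
  by have := far b bb r wr rb; lia.
apply: le_lt_trans (law_transfer A cL vL wL) _; apply: hn => // u ub r vr ru.
have := far u ub (q ++ r); rewrite cat_path wq qv vr last_cat qv ru size_cat.
by move=> /(_ isT erefl); lia.
Qed.

End Dichotomy.

Theorem theorem1p3 (R : realType) (V : choiceType) (e : rel V) (M : nat) :
  is_tree e -> locally_finite e -> infinite_set [set: V]%classic -> (0 < M)%N ->
  (transient R e -> localized R e M) /\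
  (~ transient R e -> delocalized R e M).
Proof.
move=> te lf infV M0; split; first exact: transient_localized.
exact: recurrent_delocalized.
Qed.
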